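(* Let $\theta_{\mathrm{out}}\in\mathbb{R}^d$ be the output of the MDNPG algorithm (described in the context). Assume: (1) the weight matrix $W\in\mathbb{R}^{n\times n}$ is doubly stochastic, i.e. $W\mathbf{1}_n=\mathbf{1}_n$ and $\mathbf{1}_n^{\mathsf T}W=\mathbf{1}_n^{\mathsf T}$, and $\rho:=\|W-\frac1n\mathbf{1}_n\mathbf{1}_n^{\mathsf T}\|\in[0,1)$; (2) $V^\star:=\sup_{\theta\in\mathbb{R}^d}V(\theta)<+\infty$; (3) there are constants $G,M$ with $\|\nabla_\theta\log\pi_\theta(a|s)\|_2^2\le G$ and $\|\nabla^2_\theta\log\pi_\theta(a|s)\|\le M$ for all $\theta$, $a$, $s$; (4) there is a constant $\varpi$ with $\mathrm{Var}_{\tau\sim p_i(\cdot|\theta)}(\omega(\tau|\tilde\theta,\theta))\le\varpi$ for all $\theta,\tilde\theta\in\mathbb{R}^d$ and all $i$; (5) for each $i$ there is $\nu_i$ with $\mathbb{E}_{\tau\sim p_i(\cdot|\theta)}\|g_i(\tau|\theta)-\nabla V_i(\theta)\|_2^2\le\nu_i^2$ for all $\theta$; put $\bar\nu^2=\frac1n\sum_{i=1}^n\nu_i^2$; (6) there is $\mu_F>0$ with $F_i(\theta)\succeq\mu_F I_d$ for all $\theta\in\mathbb{R}^d$ and all $i$. Let $\kappa_F=G/\mu_F$, $\Delta=V^\star-V(\bar\theta^0)$, and let $L$, $L_g$, $C_g$, $C_\omega$, $\Phi^2=L_g^2+C_g^2C_\omega^2$ be the constants defined in the context. Suppose $$0<\eta<\frac{\mu_F(1-\rho^2)^3}{\kappa_F\sqrt{1632000(L^2+\Phi^2)}}$$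 and choose $\beta$ such that $$\frac{1632000(L^2+\Phi^2)\kappa_F^2\eta^2}{n\mu_F^2(1-\rho^2)^6}\le\beta<\frac1n.$$ Then $$\mathbb{E}\|\nabla V(\theta_{\mathrm{out}})\|_2^2\le\frac{8G^2\Delta}{T\eta\mu_F}+\frac{76\bar\nu^2\kappa_F^2}{nT\beta B}+\frac{152\beta\bar\nu^2\kappa_F^2}{n}+\frac{44\rho^2\bar\nu^2\kappa_F^2}{TB(1-\rho^2)}+\frac{352\beta^2\bar\nu^2\kappa_F^2}{(1-\rho^2)^2}+\frac{352\beta\bar\nu^2\kappa_F^2}{TB(1-\rho^2)^2}+\frac{704\bar\nu^2\kappa_F^2\beta^3}{(1-\rho^2)^2}+\frac{44\rho^2\kappa_F^2}{nT(1-\rho^2)}\sum_{i=1}^n\|\nabla V_i(\bar\theta^0)\|_2^2 .$$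
   Context: **Problem.** There are $n$ agents. State and action spaces are finite. Agent $i$ has a reward function $r_i(s,a,s')\in[-1,1]$, a transition model $P_i(s'|s,a)$ and an initial state distribution $\rho_{0,i}$ (environments may coincide for all agents or differ). All agents use the same discount factor $\gamma\in[0,1)$, the same horizon $H\in\mathbb{N}$, and a common parametrized policy $\pi_\theta(a|s)$, $\theta\in\mathbb{R}^d$, with $\log\pi_\theta(a|s)$ twice differentiable in $\theta$. A trajectory $\tau=(s^0,a^0,\dots,s^{H-1},a^{H-1},s^H)$ of agent $i$ under $\pi_\theta$ has distribution $$p_i(\tau|\theta)=\rho_{0,i}(s^0)\prod_{h=0}^{H-1}\pi_\theta(a^h|s^h)P_i(s^{h+1}|s^h,a^h).$$ Put $r_i^h=r_i(s^h,a^h,s^{h+1})$, $V_i(\theta)=\mathbb{E}_{\tau\sim p_i(\cdot|\theta)}\big[\sum_{h=0}^{H-1}\gamma^hr_i^h\big]$ and $V(\theta)=\frac1n\sum_{i=1}^nV_i(\theta)$. **Estimators.** With constant baselines $b_i\in\mathbb{R}$, $$g_i(\tau|\theta)=\Big[\sum_{h=0}^{H-1}\nabla_\theta\log\pi_\theta(a^h|s^h)\Big]\Big[\sum_{h=0}^{H-1}\gamma^hr_i^h-b_i\Big],\qquad \omega(\tau|\tilde\theta,\theta)=\prod_{h=0}^{H-1}\frac{\pi_{\tilde\theta}(a^h|s^h)}{\pi_\theta(a^h|s^h)}.$$ The (scaled) Fisher information matrix of agent $i$ is $$F_i(\theta)=\mathbb{E}_{\tau\sim p_i(\cdot|\theta)}\Big[\frac1H\sum_{h=0}^{H-1}\nabla_\theta\log\pi_\theta(a^h|s^h)\big(\nabla_\theta\log\pi_\theta(a^h|s^h)\big)^{\mathsf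 T}\Big].$$ **Constants.** Let $|b|$ be a common bound with $|b_i|\le|b|$ for all $i$. With $G,M,\varpi$ as in the claim: $L=\frac{H(M+HG)}{1-\gamma}$, $L_g=\frac{HM(1+|b|)}{1-\gamma}$, $C_g=\frac{HG^{1/2}(1+|b|)}{1-\gamma}$, $C_\omega^2=H(2HG+M)(\varpi+1)$. **Network.** The agents communicate over a connected undirected graph on $\{1,\dots,n\}$; $\mathcal N(i)$ is the set of neighbours of $i$ together with $i$. The nonnegative weight matrix $W=[W_{ij}]$ satisfies $W_{ij}=0$ for $j\notin\mathcal N(i)$. $\mathbf 1_n$ is the all-one vector; $\|\cdot\|$ of a matrix is the spectral norm. **MDNPG algorithm.** Inputs: number of iterations $T\ge1$, batch size $B\ge1$, learning rate $\eta>0$, momentum parameter $\beta$, initial parameter $\bar\theta^0\in\mathbb{R}^d$. Set $\theta_i^0=\bar\theta^0$, $v_i^{-1}=0$, $y_i^0=0$, $v_i^0=\frac1B\sum_{b=1}^Bg_i(\tau_{i,b}^0|\theta_i^0)$ with $\tau_{i,1}^0,\dots,\tau_{i,B}^0$ i.i.d. from $p_i(\cdot|\theta_i^0)$. For $t=1,\dots,T$, each agent samples one trajectory $\tau_i^t\sim p_i(\cdot|\theta_i^t)$ and sets $$v_i^t=\beta g_i(\tau_i^t|\theta_i^t)+(1-\beta)\big(v_i^{t-1}+g_i(\tau_i^t|\theta_i^t)-\omega(\tau_i^t|\theta_i^{t-1},\theta_i^t)\,g_i(\tau_i^t|\theta_i^{t-1})\big).$$ For $t=0,1,\dots,T$,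 $$y_i^{t+1}=\sum_{j}W_{ij}(y_j^t+v_j^t-v_j^{t-1}),\qquad \theta_i^{t+1}=\sum_jW_{ij}\big(\theta_j^t+\eta\,\mathbf{H}_j^ty_j^{t+1}\big),\qquad \mathbf{H}_j^t=F_j(\theta_j^t)^{-1}.$$ Samples are independent across agents and of the past, conditionally on the current parameters. The output $\theta_{\mathrm{out}}$ is drawn uniformly at random from $\{\theta_i^t: 1\le i\le n,\ 0\le t\le T\}$. *)

(* Defs.v *)
From mathcomp Require Import all_boot all_order all_algebra.
From mathcomp Require Import all_classical all_reals all_analysis.
Set Implicit Arguments.
Unset Strict Implicit.
Unset Printing Implicit Defensive.
Import Order.TTheory GRing.Theory Num.Theory.
Import numFieldNormedType.Exports.
Local Open Scope classical_set_scope.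
Local Open Scope ring_scope.

Section EuclideanSpace.
Variable R : realType.

(* The library norm on ['cV_d] and ['M_(m, n)] is the max norm; it is only used
   below through the (norm-independent) notion of differentiability. *)
Definition enorm d (v : 'cV[R]_d) : R := Num.sqrt (\sum_(i < d) v i 0 ^+ 2).

Definition specnorm m n (K : 'M[R]_(m, n)) : R :=
  sup [set enorm (K *m x) | x in [set x : 'cV[R]_n | enorm x <= 1]].

Definition psdmx d (K : 'M[R]_d) : Prop :=
  K^T = K /\ forall x : 'cV[R]_d, 0 <= (x^T *m K *m x) 0 0.

Definition grad d (f : 'cV[R]_d -> R) (x : 'cV[R]_d) : 'cV[R]_d :=
  \col_i 'D_(delta_mx i 0) f x.

Definition hess d (f : 'cV[R]_d -> R) (x : 'cV[R]_d) : 'M[R]_d :=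
  \matrix_(i, j) 'D_(delta_mx j 0) (fun z => grad f z i 0) x.

Definition twice_differentiable d (f : 'cV[R]_d -> R) : Prop :=
  (forall x, differentiable f x) /\ (forall x, differentiable (grad f) x).

End EuclideanSpace.

Section FiniteProbability.
Variables (R : realType) (X : finType).

Definition is_pmf (p : X -> R) : Prop :=
  (forall x, 0 <= p x) /\ \sum_x p x = 1.

Definition pmf_mean (p : X -> R) (f : X -> R) : R := \sum_x p x * f x.

Definition pmf_var (p : X -> R) (f : X -> R) : R :=
  pmf_mean p (fun x => (f x - pmf_mean p f) ^+ 2).

End FiniteProbability.

(* [trans s a s'] is P(s' | s, a). *)
Record environment (R : realType) (S A : finType) := Environment {
  reward : S -> A -> S -> R;
  trans : S -> A -> S -> R;
  init : S -> R;
  reward_bounded : forall s a s', -1 <= reward s a s' <= 1;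
  trans_pmf : forall s a, is_pmf (trans s a);
  init_pmf : is_pmf init
}.

(* (s^0, ..., s^H) and (a^0, ..., a^{H-1}) *)
Definition traj (S A : finType) (H : nat) : Type :=
  ({ffun 'I_H.+1 -> S} * {ffun 'I_H -> A})%type.

Section Trajectory.
Variables (S A : finType) (H : nat).

Definition cur_state (tau : traj S A H) (h : 'I_H) : S :=
  tau.1 (widen_ord (leqnSn H) h).
Definition action (tau : traj S A H) (h : 'I_H) : A := tau.2 h.
Definition next_state (tau : traj S A H) (h : 'I_H) : S := tau.1 (lift ord0 h).

End Trajectory.

Section PolicyGradient.
Variables (R : realType) (S A : finType) (d H : nat) (gamma : R).
(* [pol theta s a] is pi_theta(a | s). *)
Variable pol : 'cV[R]_d -> S -> A -> R.
Implicit Types (e : environment R S A) (theta : 'cV[R]_d) (tau : traj S A H).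

Definition traj_pmf e theta tau : R :=
  init e (tau.1 ord0) *
  \prod_(h < H) (pol theta (cur_state tau h) (action tau h) *
                 trans e (cur_state tau h) (action tau h) (next_state tau h)).

Definition discounted_return e tau : R :=
  \sum_(h < H) gamma ^+ h *
    reward e (cur_state tau h) (action tau h) (next_state tau h).

Definition value e theta : R :=
  pmf_mean (traj_pmf e theta) (discounted_return e).

Definition mean_value n (envs : 'I_n -> environment R S A) theta : R :=
  n%:R^-1 * \sum_(i < n) value (envs i) theta.

Definition score theta (s : S) (a : A) : 'cV[R]_d :=
  grad (fun x => ln (pol x s a)) theta.

Definition grad_est e (b : R) tau theta : 'cV[R]_d :=
  (discounted_return e tau - b) *:
  \sum_(h < H) score theta (cur_state tau h) (action tau h).

Definition is_weight tau (theta' theta : 'cV[R]_d) : R :=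
  \prod_(h < H) (pol theta' (cur_state tau h) (action tau h) /
                 pol theta (cur_state tau h) (action tau h)).

Definition fisher e theta : 'M[R]_d :=
  \sum_tau traj_pmf e theta tau *:
    (H%:R^-1 *: \sum_(h < H)
       (score theta (cur_state tau h) (action tau h) *m
        (score theta (cur_state tau h) (action tau h))^T)).

End PolicyGradient.

Section Algorithm.
Variables (R : realType) (S A : finType) (n d H : nat) (gamma : R).
Variable pol : 'cV[R]_d -> S -> A -> R.
Variables (envs : 'I_n -> environment R S A) (b : 'I_n -> R) (W : 'M[R]_n).
Variables (T B : nat) (eta beta : R) (theta0 : 'cV[R]_d).

Local Notation traj := (traj S A H).
Local Notation g i := (grad_est gamma pol (envs i) (b i)).

Definition mix (x : 'I_n -> 'cV[R]_d) (i : 'I_n) : 'cV[R]_d :=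
  \sum_(j < n) W i j *: x j.

(* State of the network after the v- and y-updates of iteration t:
   theta^t, v^t and y^{t+1}. *)
Record state := State {
  param : 'I_n -> 'cV[R]_d;
  mom : 'I_n -> 'cV[R]_d;
  track : 'I_n -> 'cV[R]_d
}.

Definition track_update (y v v_prev : 'I_n -> 'cV[R]_d) : 'I_n -> 'cV[R]_d :=
  mix (fun j => y j + v j - v_prev j).

(* theta^{t+1} *)
Definition next_param (st : state) : 'I_n -> 'cV[R]_d :=
  mix (fun j => param st j +
    eta *: (invmx (fisher H pol (envs j) (param st j)) *m track st j)).

Definition init_state (batch : {ffun 'I_n * 'I_B -> traj}) : state :=
  let v0 i := B%:R^-1 *: \sum_(k < B) g i (batch (i, k)) theta0 in
  State (fun=> theta0) v0 (track_update (fun=> 0) v0 (fun=> 0)).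

Definition step (st : state) (tau : {ffun 'I_n -> traj}) : state :=
  let theta := next_param st in
  let v i :=
    beta *: g i (tau i) (theta i) +
    (1 - beta) *: (mom st i + g i (tau i) (theta i) -
      is_weight pol (tau i) (param st i) (theta i) *: g i (tau i) (param st i)) in
  State theta v (track_update (track st) v (mom st)).

(* Initial batches, then the trajectories sampled at iterations 1, ..., T. *)
Definition samples : Type :=
  ({ffun 'I_n * 'I_B -> traj} * T.-tuple {ffun 'I_n -> traj})%type.

Definition state_at (w : samples) (t : nat) : state :=
  foldl step (init_state w.1) (take t w.2).

(* [tnth w.2 t] is sampled at iteration t + 1, from the parameters theta^{t+1},
   which only depend on the samples of iterations 0, ..., t. *)
Definition samples_pmf (w : samples) : R :=
  (\prod_(i < n) \prod_(k < B) traj_pmf pol (envs i) theta0 (w.1 (i, k))) *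
  \prod_(t < T) \prod_(i < n)
    traj_pmf pol (envs i) (next_param (state_at w t) i) (tnth w.2 t i).

(* A run consists of the samples and of the output index (i, t), which is
   uniform and independent of the samples. *)
Definition run : Type := (samples * ('I_n * 'I_T.+1))%type.

Definition run_pmf (r : run) : R := samples_pmf r.1 * (n%:R * T.+1%:R)^-1.

Definition theta_out (r : run) : 'cV[R]_d :=
  param (state_at r.1 r.2.2) r.2.1.

End Algorithm.

Section Constants.
Variables (R : realType) (H : nat) (gamma G M varpi absb : R).

Definition smooth_L : R := H%:R * (M + H%:R * G) / (1 - gamma).
Definition L_g : R := H%:R * M * (1 + absb) / (1 - gamma).
Definition C_g : R := H%:R * Num.sqrt G * (1 + absb) / (1 - gamma).
(* the square of C_omega *)
Definition C_omega2 : R := H%:R * (2 * H%:R * G + M) * (varpi + 1).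
(* the square of Phi *)
Definition Phi2 : R := L_g ^+ 2 + C_g ^+ 2 * C_omega2.

End Constants.

(* Main.v *)
Require Import Defs.
From mathcomp Require Import all_boot all_order all_algebra.
From mathcomp Require Import all_classical all_reals all_analysis.
From mathcomp Require Import ring lra.
Set Implicit Arguments.
Unset Strict Implicit.
Unset Printing Implicit Defensive.
Import Order.TTheory GRing.Theory Num.Theory.
Import numFieldNormedType.Exports.
Local Open Scope classical_set_scope.
Local Open Scope ring_scope.

(** One iteration of the algorithm is analysed conditionally on the past, and
    everything else follows by iterating a single drift inequality.  Let [thb]
    be the average of the local parameters, [e_i] the error of the momentum
    estimate of agent [i] as an approximation of its own gradient, and [eb] the
    average of the [e_i].  The Lyapunov function [lyapunov] is a weighted sum of
    the optimality gap at [thb], of [|eb|^2], of the mean of [|e_i|^2], and of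
    the consensus errors of the parameters and of the gradient trackers.  Its
    conditional expectation after one iteration is at most its current value,
    minus the mean of [|grad V|^2] over the agents' parameters, plus a constant
    noise floor ([lyapunov_drift]).  Since it is nonnegative, summing over
    [T + 1] iterations ([lyapunov_bound]) and averaging over the initial batch
    ([lyapunov_init]) bounds the expected squared gradient at the output; it
    then remains to compare constants ([rate_constants_le]).

    The drift inequality rests on the following facts.

    - The value functions are smooth, because the score and the Hessian of the
      log-policy are bounded ([value_grad_lipschitz]), and the inverse Fisher
      matrices have their spectrum between [1 / G] and [1 / mu].  Polarization
      in the inner product that they define ([invmx_form_polar]) turns an
      iteration into a gain proportional to [|grad V thb|^2] plus the mean of
      [|y_i|^2], and a loss proportional to the mean of [|y_i - grad V thb|^2]
      ([value_ascent]).  The average of the trackers [y_i] is the average of the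
      momenta, so this loss splits orthogonally into the consensus error of the
      trackers and a term controlled by [eb] and the consensus error of the
      parameters.

    - The momentum errors satisfy [e' = (1 - beta) e + noise], where the noise
      is centered given the past.  Its variance is controlled by [beta^2 nu^2]
      and by the squared displacement of the parameter
      ([noise_second_moment]); the latter because the variance of an importance
      weight vanishes to second order when both parameters agree
      ([is_weight_variance_le]).  As the agents sample independently, the noise
      in [eb] is smaller by a factor [n].

    - Mixing contracts the deviation from the mean by the factor [rho]
      ([msqn_dev_mix_le]).

    - All displacements are bounded by consensus errors and by a small multiple
      of the mean of [|y_i|^2] ([param_drift_le]), and the conditions on [eta]
      and [beta] let the gain in [value_ascent] absorb them
      ([step_size_absorbs_track]). *)

(** * Euclidean norm and spectral norm *)

Lemma le_of_eq (R : numDomainType) (x y : R) : x = y -> x <= y.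
Proof. by move->. Qed.

Section Euclid.
Variable R : realType.

Definition dotv d (x y : 'cV[R]_d) : R := \sum_i x i 0 * y i 0.
(** The square of [enorm]; unlike the norm it is polynomial in the entries, so
    that it can be expanded and averaged. *)
Definition sqn d (x : 'cV[R]_d) : R := dotv x x.

Section Fixed.
Variable d : nat.
Implicit Types x y z : 'cV[R]_d.

Lemma dotvE x y : dotv x y = (x^T *m y) 0 0.
Proof. by rewrite mxE; apply: eq_bigr => i _; rewrite mxE. Qed.

Lemma dotvC x y : dotv x y = dotv y x.
Proof. by apply: eq_bigr => i _; rewrite mulrC. Qed.

Lemma dotvDl x y z : dotv (x + y) z = dotv x z + dotv y z.
Proof. by rewrite -big_split; apply: eq_bigr => i _ /=; rewrite mxE mulrDl. Qed.

Lemma dotvZl a x z : dotv (a *: x) z = a * dotv x z.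
Proof. by rewrite mulr_sumr; apply: eq_bigr => i _ /=; rewrite mxE mulrA. Qed.

Lemma dotvDr x y z : dotv z (x + y) = dotv z x + dotv z y.
Proof. by rewrite !(dotvC z) dotvDl. Qed.

Lemma dotvZr a x z : dotv z (a *: x) = a * dotv z x.
Proof. by rewrite !(dotvC z) dotvZl. Qed.

Lemma dotvNl x z : dotv (- x) z = - dotv x z.
Proof. by rewrite -scaleN1r dotvZl mulN1r. Qed.

Lemma dotvNr x z : dotv z (- x) = - dotv z x.
Proof. by rewrite !(dotvC z) dotvNl. Qed.

Lemma dot0v z : dotv 0 z = 0.
Proof. by rewrite -(scale0r z) dotvZl mul0r. Qed.

Lemma dotv_suml (I : Type) (r : seq I) (P : pred I) (F : I -> 'cV[R]_d) z :
  dotv (\sum_(i <- r | P i) F i) z = \sum_(i <- r | P i) dotv (F i) z.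
Proof.
by apply: (big_morph (fun x => dotv x z)) => [x y|]; rewrite ?dotvDl ?dot0v.
Qed.

Lemma dotv_sumr (I : Type) (r : seq I) (P : pred I) (F : I -> 'cV[R]_d) z :
  dotv z (\sum_(i <- r | P i) F i) = \sum_(i <- r | P i) dotv z (F i).
Proof. by rewrite dotvC dotv_suml; apply: eq_bigr => i _; rewrite dotvC. Qed.

Lemma dotv_delta (i : 'I_d) x : dotv x (delta_mx i 0) = x i 0.
Proof.
rewrite /dotv (bigD1 i) //= mxE !eqxx mulr1 big1 ?addr0 // => j /negPf ji.
by rewrite mxE ji mulr0.
Qed.

Definition dotvl := (dotvDl, dotvDr, dotvNl, dotvNr, dotvZl, dotvZr).

Lemma sqn_ge0 x : 0 <= sqn x.
Proof. by apply: sumr_ge0 => i _; rewrite -expr2 sqr_ge0. Qed.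

Lemma sqn_enorm x : enorm x ^+ 2 = sqn x.
Proof.
rewrite sqr_sqrtr; first by apply: eq_bigr => i _; rewrite expr2.
by apply: sumr_ge0 => i _; rewrite sqr_ge0.
Qed.

Lemma enorm_ge0 x : 0 <= enorm x.
Proof. exact: sqrtr_ge0. Qed.

Lemma enorm_sqrt x : enorm x = Num.sqrt (sqn x).
Proof. by rewrite -sqn_enorm sqrtr_sqr ger0_norm // enorm_ge0. Qed.

Lemma sqn0 : sqn (0 : 'cV[R]_d) = 0.
Proof. exact: dot0v. Qed.

Lemma sqn_eq0 x : (sqn x == 0) = (x == 0).
Proof.
apply/eqP/eqP => [/eqP|->]; last exact: sqn0.
rewrite psumr_eq0 => [/allP h|i _]; last by rewrite -expr2 sqr_ge0.
apply/colP => i; rewrite mxE.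
by have /eqP := h i (mem_index_enum i); rewrite -expr2 => /eqP; rewrite sqrf_eq0 => /eqP.
Qed.

Lemma sqnZ a x : sqn (a *: x) = a ^+ 2 * sqn x.
Proof. by rewrite /sqn dotvZl dotvZr mulrA expr2. Qed.

Lemma sqnN x : sqn (- x) = sqn x.
Proof. by rewrite /sqn dotvNl dotvNr opprK. Qed.

Lemma sqnD x y : sqn (x + y) = sqn x + 2 * dotv x y + sqn y.
Proof. by rewrite /sqn !dotvl (dotvC y x); ring. Qed.

Lemma sqnB x y : sqn (x - y) = sqn x - 2 * dotv x y + sqn y.
Proof. by rewrite sqnD dotvNr sqnN; ring. Qed.

Lemma sqnD_le x y : sqn (x + y) <= 2 * sqn x + 2 * sqn y.
Proof. by have := sqn_ge0 (x - y); rewrite sqnB sqnD; lra. Qed.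

(** The free parameter [c] lets the weight on [x] be as close to [1] as needed:
    a contraction applied afterwards then still contracts. *)
Lemma sqnD_young (c : R) x y : 0 < c ->
  sqn (x + y) <= (1 + c) * sqn x + (1 + c^-1) * sqn y.
Proof.
move=> c0; have h := sqn_ge0 (c *: x - y).
move: h; rewrite sqnB sqnZ dotvZl sqnD => h.
have ci : 0 < c^-1 by rewrite invr_gt0.
have {}h := mulr_ge0 (ltW ci) h.
have e : c^-1 * (c ^+ 2 * sqn x - 2 * (c * dotv x y) + sqn y)
  = c * sqn x - 2 * dotv x y + c^-1 * sqn y by field; rewrite gt_eqF.
rewrite e in h; lra.
Qed.

Lemma cauchy_schwarz2 x y : dotv x y ^+ 2 <= sqn x * sqn y.
Proof.
have [y0|y0] := eqVneq (sqn y) 0.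
  move/eqP: (y0); rewrite sqn_eq0 => /eqP ->.
  by rewrite dotvC dot0v sqn0 mulr0 expr0n.
have yp : 0 < sqn y by rewrite lt_def y0 sqn_ge0.
have := sqn_ge0 (sqn y *: x - dotv x y *: y).
rewrite sqnB !sqnZ dotvZl dotvZr => h.
have e : sqn y ^+ 2 * sqn x - 2 * (sqn y * (dotv x y * dotv x y)) + dotv x y ^+ 2 * sqn y
  = sqn y * (sqn x * sqn y - dotv x y ^+ 2) by ring.
by rewrite e pmulr_rge0 // subr_ge0 in h.
Qed.

Lemma cauchy_schwarz x y : `|dotv x y| <= enorm x * enorm y.
Proof.
rewrite -(ler_pXn2r (ltn0Sn 1)) ?nnegrE ?normr_ge0 ?mulr_ge0 ?enorm_ge0 //.
by rewrite real_normK ?num_real // exprMn !sqn_enorm cauchy_schwarz2.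
Qed.

(** The weighted variance of [u] around its weighted mean is nonnegative. *)
Lemma sqn_jensen (I : finType) (w : I -> R) (u : I -> 'cV[R]_d) :
  (forall i, 0 <= w i) -> \sum_i w i = 1 ->
  sqn (\sum_i w i *: u i) <= \sum_i w i * sqn (u i).
Proof.
move=> w0 w1; set m := \sum_i _.
have : 0 <= \sum_i w i * sqn (u i - m).
  by apply: sumr_ge0 => i _; rewrite mulr_ge0 ?sqn_ge0.
have -> : \sum_i w i * sqn (u i - m) =
    \sum_i w i * sqn (u i) - 2 * dotv m m + (\sum_i w i) * sqn m.
  rewrite {2}/m dotv_suml mulr_sumr -sumrB mulr_suml -big_split /=.
  by apply: eq_bigr => i _; rewrite sqnB dotvZl; ring.
by rewrite w1 -/(sqn m); lra.
Qed.

(** Duality, tested at [w = x]: the derivative of a vector along a line is only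
    estimated after pairing with a fixed [w], and this recovers its norm. *)
Lemma dotv_sqn_le x c : 0 <= c -> (forall w, dotv w x <= c * enorm w) -> sqn x <= c ^+ 2.
Proof.
move=> c0 h; rewrite -sqn_enorm ler_pXn2r ?nnegrE ?enorm_ge0 //.
have [x0|x0] := eqVneq (enorm x) 0; first by rewrite x0.
have xp : 0 < enorm x by rewrite lt_def x0 enorm_ge0.
by rewrite -(ler_pM2r xp) -expr2 sqn_enorm h.
Qed.

End Fixed.

Lemma mulmx_dotv m n (K : 'M[R]_(m, n)) (x : 'cV[R]_n) (y : 'cV[R]_m) :
  dotv y (K *m x) = dotv (K^T *m y) x.
Proof. by rewrite !dotvE trmx_mul trmxK mulmxA. Qed.

Lemma enormZ d a (x : 'cV[R]_d) : enorm (a *: x) = `|a| * enorm x.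
Proof. by rewrite !enorm_sqrt sqnZ sqrtrM ?sqr_ge0 // sqrtr_sqr. Qed.

(** By Cauchy-Schwarz on each row, the Frobenius norm is an upper bound; without
    boundedness the supremum that defines [specnorm] would carry no information. *)
Lemma specnorm_has_sup m n (K : 'M[R]_(m, n)) :
  has_sup [set enorm (K *m x) | x in [set x : 'cV[R]_n | enorm x <= 1]].
Proof.
split; first by exists (enorm (K *m 0)), 0 => //=; rewrite enorm_sqrt sqn0 sqrtr0.
exists (Num.sqrt (\sum_i sqn ((row i K)^T))) => _ [x /= x1 <-].
rewrite enorm_sqrt; apply: ler_wsqrtr; apply: ler_sum => i _.
have -> : (K *m x) i 0 * (K *m x) i 0 = dotv ((row i K)^T) x ^+ 2.
  rewrite expr2; congr (_ * _); rewrite mxE; apply: eq_bigr => j _; rewrite !mxE //.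
apply: le_trans (cauchy_schwarz2 _ _) _.
rewrite ler_piMr ?sqn_ge0 // -sqn_enorm expr_le1 // enorm_ge0 //.
Qed.

Lemma specnorm_ge0 m n (K : 'M[R]_(m, n)) : 0 <= specnorm K.
Proof.
have [_ ub] := specnorm_has_sup K.
apply: le_trans (enorm_ge0 (K *m 0)) _; apply: ub_le_sup => //.
by exists 0 => //=; rewrite enorm_sqrt sqn0 sqrtr0.
Qed.

Lemma specnorm_bound m n (K : 'M[R]_(m, n)) x :
  enorm (K *m x) <= specnorm K * enorm x.
Proof.
have [x0|x0] := eqVneq (enorm x) 0.
  have /eqP : sqn x == 0 by rewrite -sqn_enorm x0 expr0n.
  move/eqP; rewrite sqn_eq0 => /eqP ->.
  by rewrite mulmx0 !enorm_sqrt !sqn0 !sqrtr0 mulr0.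
have xp : 0 < enorm x by rewrite lt_def x0 enorm_ge0.
have [_ ub] := specnorm_has_sup K.
rewrite -ler_pdivrMr //; apply: ub_le_sup => //; exists ((enorm x)^-1 *: x) => /=.
  by rewrite enormZ ger0_norm ?invr_ge0 ?enorm_ge0 // mulVf.
by rewrite -scalemxAr enormZ ger0_norm ?invr_ge0 ?enorm_ge0 // mulrC.
Qed.

Lemma bilinear_bound m n (K : 'M[R]_(m, n)) c x y : specnorm K <= c ->
  `|dotv y (K *m x)| <= c * enorm y * enorm x.
Proof.
move=> Kc; apply: le_trans (cauchy_schwarz _ _) _.
rewrite [c * _]mulrC -mulrA ler_wpM2l ?enorm_ge0 //.
by apply: le_trans (specnorm_bound _ _) _; rewrite ler_wpM2r ?enorm_ge0.
Qed.

(** * Quadratic form of an inverse Fisher matrix *)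

Section Precond.
Variables (d : nat) (F : 'M[R]_d) (mu G : R).
Hypotheses (mu0 : 0 < mu) (G0 : 0 < G) (psd : psdmx (F - mu%:M))
  (Fle : forall x, dotv x (F *m x) <= G * sqn x).

Lemma psdmx_ge x : mu * sqn x <= dotv x (F *m x).
Proof.
have := psd.2 x.
by rewrite -mulmxA -dotvE mulmxBl mul_scalar_mx dotvDr dotvNr dotvZr subr_ge0.
Qed.

Lemma psdmx_tr : F^T = F.
Proof.
have := psd.1; rewrite linearB /= tr_scalar_mx => h.
by apply: (addIr (- mu%:M)).
Qed.

Lemma psdmx_unit : F \in unitmx.
Proof.
rewrite -row_free_unit -kermx_eq0; apply/rowV0P => v /sub_kermxP vF.
have : mu * sqn v^T <= 0.
  apply: le_trans (psdmx_ge _) _.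
  by rewrite -psdmx_tr -trmx_mul vF trmx0 dotvC dot0v.
rewrite pmulr_rle0 // => h.
have /eqP : sqn v^T == 0 by rewrite eq_le h sqn_ge0.
by move/eqP; rewrite sqn_eq0 => /eqP/(congr1 trmx); rewrite trmxK trmx0.
Qed.

Lemma invmx_sqn_le x : mu ^+ 2 * sqn (invmx F *m x) <= sqn x.
Proof.
set z := invmx F *m x; have xE : x = F *m z by rewrite mulKVmx ?psdmx_unit.
have h1 : mu * sqn z <= dotv z x by rewrite [in leRHS]xE psdmx_ge.
have := sqn_ge0 (x - mu *: z); rewrite sqnB dotvZr sqnZ (dotvC x z).
have : mu * (mu * sqn z) <= mu * dotv z x by rewrite ler_pM2l.
by rewrite expr2 mulrA; lra.
Qed.

Lemma invmx_form_le x : mu * dotv x (invmx F *m x) <= sqn x.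
Proof.
set z := invmx F *m x; have xE : x = F *m z by rewrite mulKVmx ?psdmx_unit.
have h1 : mu * sqn z <= dotv z x by rewrite [in leRHS]xE psdmx_ge.
have := sqn_ge0 (x - mu *: z); rewrite sqnB dotvZr sqnZ (dotvC x z).
have : mu * (mu * sqn z) <= mu * dotv z x by rewrite ler_pM2l.
by rewrite expr2 mulrA; lra.
Qed.

(** Evaluate the form of [F] at [x - G *: z] with [F *m z = x], and bound
    [dotv x (F *m x)] by [G * sqn x] in the expansion. *)
Lemma invmx_form_ge x : sqn x <= G * dotv x (invmx F *m x).
Proof.
set z := invmx F *m x; have xE : F *m z = x by rewrite mulKVmx ?psdmx_unit.
have h : 0 <= dotv (x - G *: z) (F *m (x - G *: z)).
  by apply: le_trans (psdmx_ge _); rewrite mulr_ge0 ?sqn_ge0 // ltW.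
have e : dotv z (F *m x) = sqn x by rewrite mulmx_dotv psdmx_tr xE.
move: h; rewrite mulmxBr -scalemxAr xE !dotvl e -/(sqn x).
have := Fle x; rewrite (dotvC z x) => h1 h2.
rewrite -(ler_pM2l G0); lra.
Qed.

Lemma invmx_form_sym x y : dotv x (invmx F *m y) = dotv y (invmx F *m x).
Proof. by rewrite mulmx_dotv trmx_inv psdmx_tr dotvC. Qed.

(** Polarization [2 <x, y> = |x|^2 + |y|^2 - |y - x|^2] in the inner product of
    [invmx F], followed by the bounds [1 / G] and [1 / mu] on its spectrum.  It
    makes a different preconditioner at each agent harmless: only the distance
    from the tracker [y] to the true gradient [x] is lost. *)
Lemma invmx_form_polar x y :
  (2 * G)^-1 * (sqn x + sqn y) - (2 * mu)^-1 * sqn (y - x) <=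
  dotv x (invmx F *m y).
Proof.
have h1 := invmx_form_ge x; have h2 := invmx_form_ge y.
have := invmx_form_le (y - x); rewrite mulmxBr !dotvl (invmx_form_sym y x).
rewrite -ler_pdivlMl // => h3.
rewrite -!(ler_pdivrMl _ _ G0) in h1 h2.
rewrite !invfM; lra.
Qed.

End Precond.

(** * Averages over the network and mixing *)

Section Consensus.
Variables (n d : nat).
Hypothesis n0 : (0 < n)%N.
Implicit Types x : 'I_n -> 'cV[R]_d.

Definition mean x : 'cV[R]_d := n%:R^-1 *: \sum_i x i.
Definition msqn x : R := n%:R^-1 * \sum_i sqn (x i).
Definition dev x : 'I_n -> 'cV[R]_d := fun i => x i - mean x.

Let nR : 0 < n%:R :> R.
Proof. by rewrite ltr0n. Qed.

Lemma msqn_ge0 x : 0 <= msqn x.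
Proof.
by rewrite /msqn mulr_ge0 ?invr_ge0 ?(ltW nR) // sumr_ge0 // => i _; exact: sqn_ge0.
Qed.

Lemma mean_cst c : mean (fun=> c) = c.
Proof.
by rewrite /mean sumr_const card_ord -(scaler_nat n c) scalerA mulVf ?scale1r ?gt_eqF.
Qed.

Lemma msqn_cst c : msqn (fun=> c) = sqn c.
Proof.
by rewrite /msqn sumr_const card_ord -(mulr_natl (sqn c)) mulrA mulVf ?mul1r ?gt_eqF.
Qed.

Lemma meanD x y : mean (fun i => x i + y i) = mean x + mean y.
Proof. by rewrite /mean big_split scalerDr. Qed.

Lemma meanB x y : mean (fun i => x i - y i) = mean x - mean y.
Proof. by rewrite /mean sumrB scalerBr. Qed.

Lemma meanZ a x : mean (fun i => a *: x i) = a *: mean x.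
Proof. by rewrite /mean -scaler_sumr !scalerA mulrC. Qed.

Lemma eq_mean x y : x =1 y -> mean x = mean y.
Proof. by move=> e; rewrite /mean (eq_bigr _ (fun i _ => e i)). Qed.

Lemma eq_msqn x y : x =1 y -> msqn x = msqn y.
Proof. by move=> e; rewrite /msqn (eq_bigr _ (fun i _ => congr1 _ (e i))). Qed.

Lemma msqnD_le x y : msqn (fun i => x i + y i) <= 2 * msqn x + 2 * msqn y.
Proof.
rewrite /msqn !(mulrCA 2) -mulrDr ler_pM2l ?invr_gt0 // !mulr_sumr -big_split /=.
by apply: ler_sum => i _; exact: sqnD_le.
Qed.

Lemma msqnD_young c x y : 0 < c ->
  msqn (fun i => x i + y i) <= (1 + c) * msqn x + (1 + c^-1) * msqn y.
Proof.
move=> c0; rewrite /msqn !(mulrCA (1 + _)) -mulrDr ler_pM2l ?invr_gt0 //.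
rewrite !mulr_sumr -big_split /=.
by apply: ler_sum => i _; exact: sqnD_young.
Qed.

Lemma msqnZ a x : msqn (fun i => a *: x i) = a ^+ 2 * msqn x.
Proof.
by rewrite /msqn (eq_bigr _ (fun i _ => sqnZ a (x i))) -mulr_sumr mulrCA.
Qed.

Lemma msqn_bias_variance x c :
  msqn (fun i => x i - c) = msqn (dev x) + sqn (mean x - c).
Proof.
have e : forall i, sqn (x i - c) =
    sqn (dev x i) + 2 * dotv (dev x i) (mean x - c) + sqn (mean x - c).
  by move=> i; rewrite -sqnD addrA subrK.
rewrite /msqn (eq_bigr _ (fun i _ => e i)) !big_split /= !mulrDr.
rewrite -mulr_sumr -dotv_suml.
have -> : \sum_i dev x i = 0.
  apply: (scalerI (lt0r_neq0 (_ : 0 < n%:R^-1 :> R))); first by rewrite invr_gt0.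
  by rewrite -/(mean (dev x)) meanB mean_cst subrr scaler0.
by rewrite dot0v !mulr0 addr0; congr (_ + _); exact: (msqn_cst (mean x - c)).
Qed.

Lemma sqn_mean_le x : sqn (mean x) <= msqn x.
Proof.
have := msqn_bias_variance x 0; rewrite subr0 => h.
rewrite (_ : msqn x = msqn (fun i => x i - 0)); last by apply: eq_msqn => i; rewrite subr0.
by rewrite h lerDr msqn_ge0.
Qed.

Variable W : 'M[R]_n.
Let ones : 'cV[R]_n := const_mx 1.
Hypotheses (W_row : W *m ones = ones) (W_col : ones^T *m W = ones^T)
  (W_ge0 : forall i j, 0 <= W i j).
Let rho := specnorm (W - n%:R^-1 *: (ones *m ones^T)).

Lemma mixing_row_sum i : \sum_j W i j = 1.
Proof.
have /colP/(_ i) := W_row; rewrite !mxE => <-.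
by apply: eq_bigr => j _; rewrite mxE mulr1.
Qed.

Lemma mixing_col_sum j : \sum_i W i j = 1.
Proof.
have /rowP/(_ j) := W_col; rewrite !mxE => <-.
by apply: eq_bigr => i _; rewrite !mxE mul1r.
Qed.

Lemma mean_mix x : mean (mix W x) = mean x.
Proof.
rewrite /mean /mix exchange_big /=; congr (_ *: _).
by apply: eq_bigr => j _; rewrite -scaler_suml mixing_col_sum scale1r.
Qed.

Lemma mixB_cst x c i : mix W (fun j => x j - c) i = mix W x i - c.
Proof.
rewrite /mix (eq_bigr _ (fun j _ => scalerBr (W i j) (x j) c)) sumrB.
by rewrite -scaler_suml mixing_row_sum scale1r.
Qed.

Lemma mixD x y i : mix W (fun j => x j + y j) i = mix W x i + mix W y i.
Proof. by rewrite /mix -big_split; apply: eq_bigr => j _; rewrite scalerDr. Qed.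

(** Jensen's inequality in each row, then the column sums. *)
Lemma msqn_mix_le x : msqn (mix W x) <= msqn x.
Proof.
rewrite /msqn ler_pM2l ?invr_gt0 //.
apply: le_trans (_ : \sum_i \sum_j W i j * sqn (x j) <= _).
  apply: ler_sum => i _; apply: sqn_jensen => //; exact: mixing_row_sum.
rewrite exchange_big /=; apply: ler_sum => j _.
by rewrite -mulr_suml mixing_col_sum mul1r.
Qed.

(** On each coordinate the deviations of the mixed vectors are the image of those
    of [x] under [W - J], with [J] the averaging matrix.  This matrix annihilates
    constant vectors, so any center [c] may be subtracted first. *)
Lemma msqn_dev_mix_le x c : msqn (dev (mix W x)) <= rho ^+ 2 * msqn (fun i => x i - c).
Proof.
rewrite /msqn mulrCA ler_pM2l ?invr_gt0 // mulr_sumr.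
rewrite exchange_big [leRHS](eq_bigr (fun i => \sum_k rho ^+ 2 * ((x i - c) k 0 * (x i - c) k 0))); last first.
  by move=> i _; rewrite mulr_sumr.
rewrite [leRHS]exchange_big /=; apply: ler_sum => k _.
pose X : 'cV[R]_n := \col_i (x i - c) k 0.
have eX i : (dev (mix W x) i) k 0 =
    ((W - n%:R^-1 *: (ones *m ones^T)) *m X) i 0.
  rewrite mulmxBl -scalemxAl -mulmxA /dev mean_mix -(subrK c (mix W x i)) -mixB_cst.
  have -> : mean x = c + mean (fun i => x i - c).
    by rewrite meanB mean_cst addrC subrK.
  rewrite opprD addrA addrK /mean !mxE summxE; congr (_ - _).
    by apply: eq_bigr => j _; rewrite !mxE.
  rewrite big_ord1 !mxE mul1r summxE; congr (_ * _).
  by apply: eq_bigr => j _; rewrite !mxE mul1r.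
rewrite (eq_bigr _ (fun i _ => congr2 *%R (eX i) (eX i))).
rewrite -mulr_sumr [in leRHS](eq_bigr (fun i => X i 0 * X i 0)); last by move=> i _; rewrite !mxE.
set K := W - _; change (sqn (K *m X) <= rho ^+ 2 * sqn X).
rewrite -!sqn_enorm -exprMn.
rewrite ler_pXn2r ?nnegrE ?mulr_ge0 ?enorm_ge0 ?specnorm_ge0 //.
exact: specnorm_bound.
Qed.

End Consensus.
End Euclid.

(** * Calculus along lines *)

Section Calculus.
Variable R : realType.
Implicit Types f g : R -> R.

Lemma is_derive_fin_sum (I : finType) (F : I -> R -> R) (dF : I -> R) (t : R) :
  (forall i, is_derive t 1 (F i) (dF i)) ->
  is_derive t 1 (fun s => \sum_i F i s) (\sum_i dF i).
Proof.
move=> h; rewrite (_ : (fun s => _) = \sum_i F i); last first.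
  by apply/funext => s; rewrite fct_sumE.
by elim/big_ind2: _ => // [|*]; [exact: is_derive_cst|exact: is_deriveD].
Qed.

Lemma is_derive_scale f (c t l : R) : is_derive t 1 f l -> is_derive t 1 (fun s => c * f s) (c * l).
Proof. exact: is_deriveZ. Qed.

Lemma is_derive_mul f g (t a b : R) : is_derive t 1 f a -> is_derive t 1 g b ->
  is_derive t 1 (fun s => f s * g s) (f t * b + g t * a).
Proof. exact: is_deriveM. Qed.

Lemma is_derive_expR_comp f (t a : R) : is_derive t 1 f a ->
  is_derive t 1 (fun s => expR (f s)) (expR (f t) * a).
Proof. by move=> h; apply: is_derive1_comp. Qed.

Lemma mvt_le f (df : R -> R) (K a b : R) : a <= b ->
  (forall t : R, is_derive t 1 f (df t)) ->
  (forall t : R, a <= t <= b -> df t <= K) -> f b - f a <= K * (b - a).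
Proof.
move=> ab fd dfK.
have [|c cab ->] := @MVT_segment R f df a b ab (fun t _ => fd t).
  apply/continuous_subspaceT => t.
  by apply/differentiable_continuous/derivable1_diffP; have [] := fd t.
by rewrite ler_wpM2r ?subr_ge0 ?dfK // (itvP cab).
Qed.

Lemma mvt_unit_le f (df : R -> R) (K : R) :
  (forall t : R, is_derive t 1 f (df t)) ->
  (forall t : R, df t <= K) -> f 1 - f 0 <= K.
Proof.
move=> fd dfK; rewrite -[leRHS]mulr1 -[X in K * X]subr0.
by apply: (mvt_le ler01 fd) => t _; exact: dfK.
Qed.

Lemma taylor_unit_le f (df : R -> R) (K : R) :
  (forall t : R, is_derive t 1 f (df t)) ->
  (forall t : R, 0 <= t <= 1 -> df t - df 0 <= K * t) ->
  f 1 <= f 0 + df 0 + K / 2.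
Proof.
move=> fd dfK.
pose g t := f t + (- df 0 * t + - (K / 2) * (t * t)).
have gd (t : R) : is_derive t 1 g (df t + (- df 0 * 1 + - (K / 2) * (t * 1 + t * 1))).
  have h1 := is_derive_scale (- df 0) (is_derive_id t 1).
  have h2 := is_derive_scale (- (K / 2)) (is_derive_mul (is_derive_id t 1) (is_derive_id t 1)).
  exact: is_deriveD (fd t) (is_deriveD h1 h2).
have := @mvt_le g _ 0 0 1 ler01 gd; rewrite mul0r /g => h.
suff : f 1 + (- df 0 * 1 + - (K / 2) * (1 * 1)) - (f 0 + (- df 0 * 0 + - (K / 2) * (0 * 0))) <= 0.
  lra.
by apply: h => t t01; have := dfK t t01; lra.
Qed.

Variable d : nat.
Implicit Types x u w : 'cV[R]_d.

Definition line x u (t : R) := x + t *: u.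

(** Both sides have the same difference quotient, so that directional derivatives
    obey the one-variable rules for products, exponentials and mean values. *)
Lemma is_derive_lineP (F : 'cV[R]_d -> R) x u (t l : R) :
  is_derive (line x u t) u F l <-> is_derive t 1 (fun s => F (line x u s)) l.
Proof.
have e : (fun h : R => h^-1 *: (((fun s => F (line x u s)) \o shift t) (h *: 1) - F (line x u t)))
  = (fun h => h^-1 *: ((F \o shift (line x u t)) (h *: u) - F (line x u t))).
  apply/funext => h /=; congr (_ *: (F _ - _)).
  by rewrite /line /= -[h *: 1]/(h * 1) mulr1 scalerDl addrCA addrA.
split=> -[]; rewrite /derivable /derive => h1 h2; split; rewrite /derivable /derive.
- by rewrite e.
- by rewrite -h2 e.
- by rewrite -e.
- by rewrite -h2 e.
Qed.

Lemma line0 x u : line x u 0 = x.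
Proof. by rewrite /line scale0r addr0. Qed.

Lemma line1 x y : line x (y - x) 1 = y.
Proof. by rewrite /line scale1r addrC subrK. Qed.

Lemma is_derive_grad (F : 'cV[R]_d -> R) x u :
  differentiable F x -> is_derive x u F (dotv (grad F x) u).
Proof.
move=> dF; split; first exact: diff_derivable.
rewrite deriveE // {1}(_ : u = \sum_i u i 0 *: delta_mx i 0).
  rewrite linear_sum; apply: eq_bigr => i _.
  by rewrite linearZ /= mxE deriveE // mulrC.
by rewrite [LHS]matrix_sum_delta; apply: eq_bigr => i _; rewrite big_ord1.
Qed.

Lemma grad_unique (F : 'cV[R]_d -> R) x (g : 'cV[R]_d) :
  (forall u, is_derive x u F (dotv g u)) -> grad F x = g.
Proof.
move=> h; apply/colP => i; rewrite mxE.
by rewrite (@derive_val _ _ _ _ _ _ _ (h (delta_mx i 0))) dotv_delta.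
Qed.

(** Differentiability of the whole gradient makes its directional derivative
    linear in [u], hence a combination of the entries of [hess]. *)
Lemma is_derive_hess (F : 'cV[R]_d -> R) x u w :
  differentiable (grad F) x ->
  is_derive x u (fun z => dotv w (grad F z)) (dotv w (hess F x *m u)).
Proof.
move=> dF.
have dFi i : differentiable (fun z => grad F z i 0) x.
  exact: (differentiable_comp dF (differentiable_coord _ i 0)).
have h i : is_derive x u (fun z => grad F z i 0) ((hess F x *m u) i 0).
  suff -> : (hess F x *m u) i 0 = dotv (grad (fun z => grad F z i 0) x) u by exact: is_derive_grad.
  by rewrite mxE; apply: eq_bigr => j _; rewrite !mxE.
rewrite (_ : (fun z => _) = \sum_i (fun z => w i 0 * grad F z i 0)); last first.
  by apply/funext => s; rewrite fct_sumE.
by apply: is_derive_sum => i; apply: is_deriveZ.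
Qed.

End Calculus.

(** * Trajectories and the policy gradient *)

Section FfunRecl.
Variables (R : realType) (T : finType) (n : nat).

Definition ffun_cons (p : T * {ffun 'I_n -> T}) : {ffun 'I_n.+1 -> T} :=
  [ffun i => if unlift ord0 i is Some j then p.2 j else p.1].

Lemma ffun_cons0 p : ffun_cons p ord0 = p.1.
Proof. by rewrite ffunE unlift_none. Qed.

Lemma ffun_consS p j : ffun_cons p (lift ord0 j) = p.2 j.
Proof. by rewrite ffunE liftK. Qed.

Lemma sum_ffun_recl (F : {ffun 'I_n.+1 -> T} -> R) :
  \sum_f F f = \sum_x \sum_(f : {ffun 'I_n -> T}) F (ffun_cons (x, f)).
Proof.
rewrite pair_big /=.
pose uncons (f : {ffun 'I_n.+1 -> T}) := (f ord0, [ffun j => f (lift ord0 j)]).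
have consK : cancel ffun_cons uncons.
  move=> [x f]; rewrite /uncons ffun_cons0; congr (_, _).
  by apply/ffunP => j; rewrite ffunE ffun_consS.
have unconsK : cancel uncons ffun_cons.
  move=> f; apply/ffunP => i; rewrite ffunE /=.
  by case: unliftP => [j ->|->]; rewrite ?ffunE.
rewrite (reindex ffun_cons) /=; first by apply: eq_bigr => -[x f].
by apply: onW_bij; exists uncons.
Qed.

End FfunRecl.

Section Policy.
Variables (R : realType) (S A : finType) (d H : nat) (gamma : R).
Variable pol : 'cV[R]_d -> S -> A -> R.
Hypotheses (pol_gt0 : forall theta s a, 0 < pol theta s a)
  (pol_pmf : forall theta s, is_pmf (pol theta s))
  (pol_diff : forall s a, twice_differentiable (fun theta => ln (pol theta s a))).
Implicit Types (e : environment R S A) (x y u w theta : 'cV[R]_d).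

(** Induction from the left: the first transition is absorbed into the weight of
    the next state, which is why the initial weight [f] is arbitrary. *)
Lemma sum_markov_chain H' (f : S -> R) (Q : S -> A -> S -> R) :
  (forall s, \sum_a \sum_s' Q s a s' = 1) ->
  \sum_(tau : traj S A H') f (tau.1 ord0) *
    \prod_(h < H') Q (cur_state tau h) (action tau h) (next_state tau h)
  = \sum_s f s.
Proof.
move=> Q1; elim: H' f => [|k IH] f.
  rewrite (eq_bigr (fun tau : traj S A 0 => f (tau.1 ord0) * 1)); last first.
    by move=> tau _; rewrite big_ord0.
  rewrite -(pair_bigA _ (fun (s : {ffun 'I_1 -> S}) (a : {ffun 'I_0 -> A}) => f (s ord0) * 1)) /=.
  rewrite sum_ffun_recl; apply: eq_bigr => s _.
  rewrite (big_pred1 [ffun i => s]); last first.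
    by move=> g; apply/esym/eqP/ffunP => -[].
  rewrite (big_pred1 [ffun i : 'I_0 => match i with Ordinal m lt_m => False_rect A (notF lt_m) end]) ?ffun_cons0 ?mulr1 //.
  by move=> g; apply/esym/eqP/ffunP => -[].
pose f' s' := \sum_s \sum_a f s * Q s a s'.
transitivity (\sum_s' f' s'); last first.
  rewrite /f' exchange_big /=; apply: eq_bigr => s _.
  rewrite exchange_big /= -[RHS]mulr1 -(Q1 s) mulr_sumr.
  by apply: eq_bigr => a _; rewrite mulr_sumr.
rewrite -(IH f').
rewrite -(pair_bigA _ (fun (s : {ffun 'I_k.+2 -> S}) (a : {ffun 'I_k.+1 -> A}) =>
  f (s ord0) * \prod_(h < k.+1) Q (cur_state (s, a) h) (action (s, a) h) (next_state (s, a) h))).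
rewrite sum_ffun_recl exchange_big /=.
rewrite -(pair_bigA _ (fun (s : {ffun 'I_k.+1 -> S}) (a : {ffun 'I_k -> A}) =>
  f' (s ord0) * \prod_(h < k) Q (cur_state (s, a) h) (action (s, a) h) (next_state (s, a) h))) /=.
apply: eq_bigr => s _.
under eq_bigr => s0 _ do rewrite sum_ffun_recl exchange_big.
rewrite exchange_big /=; apply: eq_bigr => a _.
rewrite /f' mulr_suml; apply: eq_bigr => s0 _.
rewrite mulr_suml; apply: eq_bigr => a0 _.
rewrite ffun_cons0 big_ord_recl mulrA; congr (_ * _ * _).
- congr (Q _ _ _); rewrite ?/cur_state ?/action ?/next_state /= ?ffun_cons0 ?ffun_consS //.
  by rewrite (_ : widen_ord _ _ = ord0) ?ffun_cons0 //; exact/val_inj.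
- apply: eq_bigr => h _; congr (Q _ _ _); rewrite ?/cur_state ?/action ?/next_state /= ?ffun_consS //.
  by rewrite (_ : widen_ord _ _ = lift ord0 (widen_ord (leqnSn k) h)) ?ffun_consS //; exact/val_inj.
Qed.

Lemma traj_pmf_ge0 e theta (tau : traj S A H) : 0 <= traj_pmf pol e theta tau.
Proof.
rewrite mulr_ge0 ?(init_pmf e).1 // prodr_ge0 // => h _.
by rewrite mulr_ge0 ?(trans_pmf e _ _).1 ?ltW.
Qed.

Lemma traj_pmf_sum1 e theta : \sum_(tau : traj S A H) traj_pmf pol e theta tau = 1.
Proof.
rewrite (sum_markov_chain H (init e) (Q := fun s a s' => pol theta s a * trans e s a s')).
  exact: (init_pmf e).2.
move=> s; rewrite -[RHS](pol_pmf theta s).2; apply: eq_bigr => a _.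
by rewrite -mulr_sumr (trans_pmf e s a).2 mulr1.
Qed.

Lemma traj_pmf_is_pmf e theta : is_pmf (@traj_pmf R S A d H pol e theta).
Proof. by split; [exact: traj_pmf_ge0|exact: traj_pmf_sum1]. Qed.

Lemma traj_is_weight e theta theta' (tau : traj S A H) :
  traj_pmf pol e theta tau * is_weight pol tau theta' theta = traj_pmf pol e theta' tau.
Proof.
rewrite /traj_pmf /is_weight -mulrA -big_split; congr (_ * _).
by apply: eq_bigr => h _ /=; field; rewrite gt_eqF.
Qed.

Section Trajectory.
Variable tau : traj S A H.

Definition traj_log theta : R :=
  \sum_(h < H) ln (pol theta (cur_state tau h) (action tau h)).
Definition traj_score theta : 'cV[R]_d :=
  \sum_(h < H) score pol theta (cur_state tau h) (action tau h).
Definition traj_hess theta : 'M[R]_d :=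
  \sum_(h < H) hess (fun x => ln (pol x (cur_state tau h) (action tau h))) theta.

Lemma expR_traj_log theta :
  expR (traj_log theta) = \prod_(h < H) pol theta (cur_state tau h) (action tau h).
Proof. by rewrite expR_sum; apply: eq_bigr => h _; rewrite lnK ?posrE. Qed.

Lemma traj_pmf_expR e theta : traj_pmf pol e theta tau =
  init e (tau.1 ord0) *
  \prod_(h < H) trans e (cur_state tau h) (action tau h) (next_state tau h) *
  expR (traj_log theta).
Proof. by rewrite /traj_pmf big_split /= expR_traj_log; ring. Qed.

Lemma is_weight_expR theta' theta :
  is_weight pol tau theta' theta = expR (traj_log theta' + - traj_log theta).
Proof. by rewrite expRD expRN !expR_traj_log /is_weight prodf_div. Qed.

Lemma is_derive_traj_log x u t : is_derive (t : R) 1 (fun s => traj_log (line x u s))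
  (dotv (traj_score (line x u t)) u).
Proof.
rewrite dotv_suml; apply: is_derive_fin_sum => h.
apply/(is_derive_lineP (fun z => ln (pol z (cur_state tau h) (action tau h)))).
by apply/is_derive_grad; have [] := pol_diff (cur_state tau h) (action tau h).
Qed.

Lemma is_derive_traj_score x u w t : is_derive (t : R) 1
  (fun s => dotv w (traj_score (line x u s))) (dotv w (traj_hess (line x u t) *m u)).
Proof.
rewrite (_ : (fun s => _) = (fun s => \sum_(h < H) dotv w
   (score pol (line x u s) (cur_state tau h) (action tau h)))); last first.
  by apply/funext => s; rewrite dotv_sumr.
rewrite mulmx_suml dotv_sumr; apply: is_derive_fin_sum => h.
apply/(is_derive_lineP (fun z => dotv w (score pol z (cur_state tau h) (action tau h)))).
by apply/is_derive_hess; have [] := pol_diff (cur_state tau h) (action tau h).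
Qed.

Lemma is_derive_traj_pmf e x u t : is_derive (t : R) 1
  (fun s => traj_pmf pol e (line x u s) tau)
  (traj_pmf pol e (line x u t) tau * dotv (traj_score (line x u t)) u).
Proof.
rewrite (_ : (fun s => _) = (fun s => init e (tau.1 ord0) *
  \prod_(h < H) trans e (cur_state tau h) (action tau h) (next_state tau h) *
  expR (traj_log (line x u s)))); last by apply/funext => s; rewrite traj_pmf_expR.
by rewrite traj_pmf_expR -mulrA; apply/is_derive_scale/is_derive_expR_comp/is_derive_traj_log.
Qed.

End Trajectory.

(** The policy gradient: the gradient of [value] by [grad_value]. *)
Definition value_grad e theta : 'cV[R]_d :=
  \sum_(tau : traj S A H)
    (traj_pmf pol e theta tau * discounted_return gamma e tau) *: traj_score tau theta.

Lemma dotv_value_grad e theta w : dotv w (value_grad e theta) =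
  \sum_(tau : traj S A H) traj_pmf pol e theta tau *
    (discounted_return gamma e tau * dotv w (traj_score tau theta)).
Proof. by rewrite dotv_sumr; apply: eq_bigr => tau _; rewrite dotvZr mulrA. Qed.

Lemma is_derive_value e x u t : is_derive (t : R) 1
  (fun s => value H gamma pol e (line x u s)) (dotv u (value_grad e (line x u t))).
Proof.
rewrite dotv_value_grad; apply: is_derive_fin_sum => tau.
rewrite (_ : (fun s => _) = (fun s => discounted_return gamma e tau * traj_pmf pol e (line x u s) tau)); last first.
  by apply/funext => s; rewrite mulrC.
by rewrite mulrCA (dotvC u); apply/is_derive_scale/is_derive_traj_pmf.
Qed.

Lemma grad_value e : grad (value H gamma pol e) = value_grad e.
Proof.
apply/funext => theta; apply: grad_unique => u.
have := is_derive_value e theta u 0; rewrite line0 dotvC => h.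
by have := (is_derive_lineP (value H gamma pol e) theta u 0 _).2 h; rewrite line0.
Qed.

(** Differentiate the total mass of [traj_pmf], which is constantly [1], in the
    direction of the mean score itself. *)
Lemma score_centered e theta :
  \sum_(tau : traj S A H) traj_pmf pol e theta tau *: traj_score tau theta = 0.
Proof.
apply/eqP; rewrite -sqn_eq0; apply/eqP.
set g := \sum_tau _; rewrite /sqn {1}/g dotv_suml.
have h := is_derive_fin_sum (fun tau => is_derive_traj_pmf tau e theta g 0).
have e1 : (fun s : R => \sum_(tau : traj S A H) traj_pmf pol e (line theta g s) tau) = cst 1.
  by apply/funext => s; exact: traj_pmf_sum1.
rewrite e1 in h; have := @derive_val _ _ _ _ _ _ _ h.
rewrite derive_cst line0 => e0; rewrite [RHS]e0.
by apply: eq_bigr => tau _; rewrite dotvZl.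
Qed.

Lemma grad_estE e b tau theta :
  grad_est gamma pol e b tau theta = (discounted_return gamma e tau - b) *: traj_score tau theta.
Proof. by []. Qed.

(** The baseline multiplies the mean score, which vanishes. *)
Lemma grad_est_unbiased e b theta :
  \sum_(tau : traj S A H) traj_pmf pol e theta tau *: grad_est gamma pol e b tau theta
  = value_grad e theta.
Proof.
rewrite (eq_bigr (fun tau : traj S A H =>
  (traj_pmf pol e theta tau * discounted_return gamma e tau) *: traj_score tau theta
  - b *: (traj_pmf pol e theta tau *: traj_score tau theta))); last first.
  by move=> tau _; rewrite grad_estE scalerA mulrBr scalerBl scalerA (mulrC b).
by rewrite sumrB -scaler_sumr score_centered scaler0 subr0.
Qed.

(** A change of measure from [theta] to [theta']. *)
Lemma weighted_grad_est_unbiased e b theta theta' :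
  \sum_(tau : traj S A H) traj_pmf pol e theta tau *:
    (is_weight pol tau theta' theta *: grad_est gamma pol e b tau theta')
  = value_grad e theta'.
Proof.
rewrite -(grad_est_unbiased e b); apply: eq_bigr => tau _.
by rewrite scalerA traj_is_weight.
Qed.

(** * Smoothness and importance weights *)

Section Bounds.
Variables (G M varpi absb : R).
Hypotheses (gamma01 : 0 <= gamma < 1) (absb0 : 0 <= absb).
Hypothesis score_le : forall theta s a, enorm (score pol theta s a) ^+ 2 <= G.
Hypothesis hess_le : forall theta s a,
  specnorm (hess (fun x => ln (pol x s a)) theta) <= M.

Let L := smooth_L H gamma G M.
Let Lg := L_g H gamma M absb.
Let Cg := C_g H gamma G absb.
Let Cw2 := C_omega2 H G M varpi.

Lemma discounted_return_le e (tau : traj S A H) : `|discounted_return gamma e tau| <= (1 - gamma)^-1.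
Proof.
have /andP[g0 g1] := gamma01; have g1' : 0 < 1 - gamma by rewrite subr_gt0.
apply: (le_trans (ler_norm_sum _ _ _)).
apply: (@le_trans _ _ (\sum_(h < H) gamma ^+ h)).
  apply: ler_sum => h _; rewrite normrM ger0_norm ?exprn_ge0 //.
  rewrite ler_piMr ?exprn_ge0 // ler_norml.
  by have := reward_bounded e (cur_state tau h) (action tau h) (next_state tau h).
rewrite -[leRHS]mul1r ler_pdivlMr // mulrC.
have := subrX1 gamma H; have := exprn_ge0 H g0.
set s := \sum_(i < H) _ => h1 h2; lra.
Qed.

Hypothesis (G0 : 0 <= G) (M0 : 0 <= M).

Lemma dotv_score_le theta s a w : `|dotv w (score pol theta s a)| <= Num.sqrt G * enorm w.
Proof.
apply: (le_trans (cauchy_schwarz _ _)); rewrite mulrC ler_wpM2r ?enorm_ge0 //.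
by rewrite -[leLHS]ger0_norm ?enorm_ge0 // -sqrtr_sqr ler_wsqrtr.
Qed.

Lemma norm_sum_ord_le (F : 'I_H -> R) c : (forall h, `|F h| <= c) -> `|\sum_h F h| <= H%:R * c.
Proof.
move=> h; apply: (le_trans (ler_norm_sum _ _ _)).
apply: (@le_trans _ _ (\sum_(h < H) c)); first exact: ler_sum.
by rewrite sumr_const card_ord mulr_natl.
Qed.

Lemma dotv_traj_score_le theta tau w :
  `|dotv w (traj_score tau theta)| <= H%:R * Num.sqrt G * enorm w.
Proof.
by rewrite dotv_sumr -mulrA; apply: norm_sum_ord_le => h; exact: dotv_score_le.
Qed.

Lemma dotv_traj_hess_le theta tau w u :
  `|dotv w (traj_hess tau theta *m u)| <= H%:R * M * enorm w * enorm u.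
Proof.
rewrite mulmx_suml dotv_sumr -2!mulrA; apply: norm_sum_ord_le => h.
by rewrite mulrA; exact: bilinear_bound.
Qed.

Lemma dotv_traj_score_mul_le theta tau w u :
  `|dotv w (traj_score tau theta) * dotv u (traj_score tau theta)| <=
  H%:R ^+ 2 * G * enorm w * enorm u.
Proof.
rewrite normrM; apply: le_trans (ler_pM _ _ (dotv_traj_score_le _ _ _) (dotv_traj_score_le _ _ _)) _ => //.
apply: le_of_eq.
by rewrite -{3}(sqr_sqrtr G0); ring.
Qed.

Lemma traj_score_sqn_le tau theta : sqn (traj_score tau theta) <= H%:R ^+ 2 * G.
Proof.
rewrite -[in leRHS](sqr_sqrtr G0) -exprMn; apply: dotv_sqn_le => [|w].
  by rewrite mulr_ge0 ?sqrtr_ge0.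
exact: le_trans (ler_norm _) (dotv_traj_score_le _ _ _).
Qed.

Lemma traj_score_lipschitz tau x y :
  sqn (traj_score tau y - traj_score tau x) <= (H%:R * M) ^+ 2 * sqn (y - x).
Proof.
rewrite -(sqn_enorm (y - x)) -exprMn; apply: dotv_sqn_le => [|w].
  by rewrite !mulr_ge0 ?enorm_ge0.
have h := is_derive_traj_score tau x (y - x) w.
set K := (X in _ <= X); have := mvt_unit_le (K := K) h.
rewrite line0 line1 dotvDr dotvNr; apply => t; rewrite {}/K.
apply: (le_trans (ler_norm _)).
by rewrite -mulrA (mulrC (enorm _)) mulrA; exact: dotv_traj_hess_le.
Qed.

Lemma pmf_mean_le (f : traj S A H -> R) e theta c :
  (forall tau, f tau <= c) -> \sum_tau traj_pmf pol e theta tau * f tau <= c.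
Proof.
move=> h; rewrite -[leRHS]mul1r -(traj_pmf_sum1 e theta) mulr_suml.
by apply: ler_sum => tau _; rewrite ler_wpM2l ?traj_pmf_ge0.
Qed.

(** Along a line the derivative is the mean of the return times the Hessian plus
    the square of the score; the two summands give the two summands of [L]. *)
Lemma value_grad_lipschitz e x y w :
  `|dotv w (value_grad e y - value_grad e x)| <= L * enorm w * enorm (y - x).
Proof.
wlog suff one_sided : w / dotv w (value_grad e y - value_grad e x) <= L * enorm w * enorm (y - x).
  rewrite ler_norml one_sided andbT lerNl -dotvNl.
  by have := one_sided (- w); rewrite !enorm_sqrt sqnN.
have /andP[g0 g1] := gamma01; have g1' : 0 < 1 - gamma by rewrite subr_gt0.
set u := y - x.
have h t : is_derive (t : R) 1 (fun s => dotv w (value_grad e (line x u s)))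
  (\sum_tau traj_pmf pol e (line x u t) tau * (discounted_return gamma e tau *
    (dotv w (traj_hess tau (line x u t) *m u) +
     dotv w (traj_score tau (line x u t)) * dotv u (traj_score tau (line x u t))))).
  rewrite (_ : (fun s => _) = (fun s => \sum_tau traj_pmf pol e (line x u s) tau *
    (discounted_return gamma e tau * dotv w (traj_score tau (line x u s))))); last first.
    by apply/funext => s; rewrite dotv_value_grad.
  apply: is_derive_fin_sum => tau.
  have := is_derive_mul (is_derive_traj_pmf tau e x u t)
    (is_derive_scale (discounted_return gamma e tau) (is_derive_traj_score tau x u w t)).
  by congr (is_derive _ _ _ _); rewrite (dotvC _ u); ring.
set K := (X in _ <= X); have := mvt_unit_le (K := K) h.
rewrite line0 line1 dotvDr dotvNr; apply => t; rewrite {}/K.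
apply: pmf_mean_le => tau; apply: (le_trans (ler_norm _)); rewrite normrM.
apply: (@le_trans _ _ ((1 - gamma)^-1 * (H%:R * M * enorm w * enorm u + H%:R ^+ 2 * G * enorm w * enorm u))).
  apply: ler_pM => //; first exact: discounted_return_le.
  apply: (le_trans (ler_normD _ _)); apply: lerD; first exact: dotv_traj_hess_le.
  exact: dotv_traj_score_mul_le.
by apply: le_of_eq; rewrite /L /smooth_L; ring.
Qed.

Lemma value_grad_sqn_lipschitz e x y :
  sqn (value_grad e y - value_grad e x) <= L ^+ 2 * sqn (y - x).
Proof.
have /andP[g0 g1] := gamma01; have g1' : 0 < 1 - gamma by rewrite subr_gt0.
have L0 : 0 <= L.
  by rewrite /L /smooth_L divr_ge0 ?(ltW g1') // mulr_ge0 // addr_ge0 // mulr_ge0.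
rewrite -(sqn_enorm (y - x)) -exprMn; apply: dotv_sqn_le => [|w]; first by rewrite mulr_ge0 ?enorm_ge0.
apply: le_trans (ler_norm _) _; apply: le_trans (value_grad_lipschitz _ _ _ _) _.
by rewrite -mulrA (mulrC (enorm _)) mulrA.
Qed.

Section Estimator.
Variables (e : environment R S A) (b : R).
Hypothesis b_le : `|b| <= absb.

Lemma centered_return_le (tau : traj S A H) :
  (discounted_return gamma e tau - b) ^+ 2 <= ((1 + absb) / (1 - gamma)) ^+ 2.
Proof.
have /andP[g0 g1] := gamma01; have g1' : 0 < 1 - gamma by rewrite subr_gt0.
have c0 : 0 <= (1 + absb) / (1 - gamma).
  by apply: divr_ge0; [rewrite addr_ge0|exact: ltW].
rewrite -[leLHS]real_normK ?num_real // ler_pXn2r ?nnegrE //.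
apply: (le_trans (ler_normB _ _)); rewrite mulrDl mul1r lerD ?discounted_return_le //.
by apply: le_trans b_le _; rewrite ler_pdivlMr // ler_piMr //; lra.
Qed.

Lemma grad_est_sqn_le (tau : traj S A H) theta : sqn (grad_est gamma pol e b tau theta) <= Cg ^+ 2.
Proof.
rewrite grad_estE sqnZ.
apply: (le_trans (ler_pM _ _ (centered_return_le tau) (traj_score_sqn_le tau theta))); rewrite ?sqr_ge0 ?sqn_ge0 //.
by apply: le_of_eq; rewrite -[in LHS](sqr_sqrtr G0) /Cg /C_g; ring.
Qed.

Lemma grad_est_lipschitz (tau : traj S A H) x y :
  sqn (grad_est gamma pol e b tau y - grad_est gamma pol e b tau x) <= Lg ^+ 2 * sqn (y - x).
Proof.
rewrite !grad_estE -scalerBr sqnZ.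
apply: (le_trans (ler_pM _ _ (centered_return_le tau) (traj_score_lipschitz tau x y))); rewrite ?sqr_ge0 ?sqn_ge0 //.
by apply: le_of_eq; rewrite /Lg /L_g; ring.
Qed.

End Estimator.

Section Variance.
Variable e : environment R S A.
Hypothesis varpi_le : forall theta theta',
  pmf_var (traj_pmf pol e theta)
    (fun tau : traj S A H => is_weight pol tau theta' theta) <= varpi.

Lemma is_weight_mean1 theta theta' :
  \sum_(tau : traj S A H) traj_pmf pol e theta tau * is_weight pol tau theta' theta = 1.
Proof.
by rewrite -(traj_pmf_sum1 e theta'); apply: eq_bigr => tau _; rewrite traj_is_weight.
Qed.

Lemma is_weight_second_moment theta theta' :
  \sum_(tau : traj S A H) traj_pmf pol e theta tau * is_weight pol tau theta' theta ^+ 2 =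
  1 + \sum_(tau : traj S A H) traj_pmf pol e theta tau * (is_weight pol tau theta' theta - 1) ^+ 2.
Proof.
apply/eqP; rewrite -subr_eq -sumrB; apply/eqP.
transitivity (\sum_(tau : traj S A H) (2 * (traj_pmf pol e theta tau * is_weight pol tau theta' theta)
   - traj_pmf pol e theta tau)).
  by apply: eq_bigr => tau _; ring.
by rewrite sumrB -mulr_sumr is_weight_mean1 traj_pmf_sum1; ring.
Qed.

Lemma is_weight_second_moment_le theta theta' :
  \sum_(tau : traj S A H) traj_pmf pol e theta tau * is_weight pol tau theta' theta ^+ 2 <= varpi + 1.
Proof.
rewrite is_weight_second_moment addrC lerD2r.
by have := varpi_le theta theta'; rewrite /pmf_var /pmf_mean is_weight_mean1.
Qed.

(** Along the segment from [x] to [y], the second moment [f] of the weight is [1]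
    with zero slope at the start, because the score is centered.  Its second
    derivative is a mean of [om^2 (4 <u, score>^2 + 2 <u, hess u>)], bounded
    through the assumed bound on the variance at all intermediate parameters. *)
Lemma is_weight_variance_le x y :
  \sum_(tau : traj S A H) traj_pmf pol e x tau * (is_weight pol tau y x - 1) ^+ 2 <= Cw2 * sqn (y - x).
Proof.
set u := y - x; set p := traj_pmf pol e x.
pose W tau s := expR (2 * (traj_log tau (line x u s) + - traj_log tau x)).
have WE tau s : W tau s = is_weight pol tau (line x u s) x ^+ 2.
  by rewrite is_weight_expR -expRM_natl.
pose f (s : R) := \sum_tau p tau * W tau s.
pose df (s : R) := \sum_tau p tau * (W tau s * (2 * dotv u (traj_score tau (line x u s)))).
pose ddf (s : R) := \sum_tau p tau * (W tau s * (2 * dotv u (traj_hess tau (line x u s) *m u))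
   + (2 * dotv u (traj_score tau (line x u s))) * (W tau s * (2 * dotv u (traj_score tau (line x u s))))).
have dW tau (t : R) : is_derive t 1 (W tau) (W tau t * (2 * dotv u (traj_score tau (line x u t)))).
  apply/is_derive_expR_comp/is_derive_scale; rewrite -[dotv _ _]addr0 dotvC.
  exact: is_deriveD (is_derive_traj_log tau x u t) (is_derive_cst (- traj_log tau x) t 1).
have hf (t : R) : is_derive t 1 f (df t) by apply: is_derive_fin_sum => tau; apply: is_derive_scale.
have hdf (t : R) : is_derive t 1 df (ddf t).
  apply: is_derive_fin_sum => tau; apply: is_derive_scale.
  exact: is_derive_mul (dW tau t) (is_derive_scale 2 (is_derive_traj_score tau x u u t)).
have ddf_le t : ddf t <= 2 * (Cw2 * sqn u).
  apply: (@le_trans _ _ (\sum_(tau : traj S A H) p tau * is_weight pol tau (line x u t) x ^+ 2 *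
     (2 * (H%:R * (2 * H%:R * G + M)) * sqn u))).
    apply: ler_sum => tau _; rewrite -[leRHS]mulrA ler_wpM2l ?traj_pmf_ge0 // -WE.
    set s := dotv u (traj_score _ _).
    rewrite [X in X <= _](_ : _ = W tau t * (2 * dotv u (traj_hess tau (line x u t) *m u) + 4 * (s * s))); last by ring.
    rewrite ler_wpM2l ?expR_ge0 //.
    have h1 := le_trans (ler_norm _) (dotv_traj_hess_le (line x u t) tau u u).
    have h2 := le_trans (ler_norm _) (dotv_traj_score_mul_le (line x u t) tau u u).
    rewrite -/s in h2; rewrite -sqn_enorm; lra.
  rewrite -mulr_suml.
  have c0 : 0 <= 2 * (H%:R * (2 * H%:R * G + M)) * sqn u.
    by rewrite mulr_ge0 ?sqn_ge0 // !mulr_ge0 // addr_ge0 // !mulr_ge0.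
  apply: (le_trans (ler_wpM2r c0 (is_weight_second_moment_le x (line x u t)))).
  by apply: le_of_eq; rewrite /Cw2 /C_omega2; ring.
have f1 : f 1 = 1 + \sum_tau p tau * (is_weight pol tau y x - 1) ^+ 2.
  rewrite -is_weight_second_moment; apply: eq_bigr => tau _; by rewrite WE line1.
have W0 tau : W tau 0 = 1 by rewrite /W line0 subrr mulr0 expR0.
have f0 : f 0 = 1.
  by rewrite -(traj_pmf_sum1 e x); apply: eq_bigr => tau _; rewrite W0 mulr1.
have df0 : df 0 = 0.
  transitivity (2 * dotv u (\sum_tau p tau *: traj_score tau x)).
    rewrite dotv_sumr mulr_sumr; apply: eq_bigr => tau _.
    by rewrite W0 line0 dotvZr; ring.
  by rewrite score_centered dotvC dot0v mulr0.
have := taylor_unit_le hf (K := 2 * (Cw2 * sqn u)).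
rewrite f1 f0 df0 addr0 => /(_ _)/(le_trans _)-h.
suff : 1 + \sum_tau p tau * (is_weight pol tau y x - 1) ^+ 2 <= 1 + 2 * (Cw2 * sqn u) / 2 by lra.
apply: h => // t /andP[t0 t1]; rewrite -df0 -{2}[t]subr0.
by apply: (mvt_le t0 hdf) => s _; exact: ddf_le.
Qed.

(** The difference is [g x - g y], controlled by the Lipschitz constant [Lg], plus
    [(1 - om) g y], controlled by the variance of the weight. *)
Lemma grad_est_difference_second_moment b x y : `|b| <= absb ->
  \sum_(tau : traj S A H) traj_pmf pol e x tau *
    sqn (grad_est gamma pol e b tau x -
         is_weight pol tau y x *: grad_est gamma pol e b tau y) <=
  2 * Phi2 H gamma G M varpi absb * sqn (y - x).
Proof.
move=> b_le.
have step (tau : traj S A H) : sqn (grad_est gamma pol e b tau x - is_weight pol tau y x *: grad_est gamma pol e b tau y) <=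
  2 * (Lg ^+ 2 * sqn (y - x)) + 2 * Cg ^+ 2 * (is_weight pol tau y x - 1) ^+ 2.
  set g := grad_est gamma pol e b tau; set om := is_weight _ _ _ _.
  rewrite -sqnN (_ : - (g x - om *: g y) = (g y - g x) + (om - 1) *: g y); last first.
    by rewrite scalerBl scale1r opprB [RHS]addrC addrA subrK.
  apply: le_trans (sqnD_le _ _) _; rewrite -(mulrA 2 (Cg ^+ 2)) lerD // ler_pM2l //.
    exact: grad_est_lipschitz.
  by rewrite sqnZ mulrC ler_wpM2r ?sqr_ge0 //; exact: grad_est_sqn_le.
apply: (@le_trans _ _ (\sum_(tau : traj S A H) (traj_pmf pol e x tau * (2 * (Lg ^+ 2 * sqn (y - x))) +
   2 * Cg ^+ 2 * (traj_pmf pol e x tau * (is_weight pol tau y x - 1) ^+ 2)))).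
  apply: ler_sum => tau _; rewrite (mulrCA (2 * Cg ^+ 2)) -mulrDr.
  by rewrite ler_wpM2l ?traj_pmf_ge0.
rewrite big_split -mulr_suml traj_pmf_sum1 -mulr_sumr mul1r.
have h := is_weight_variance_le x y.
have c0 : 0 <= 2 * Cg ^+ 2 by rewrite mulr_ge0 ?sqr_ge0.
have := ler_wpM2l c0 h; rewrite /Phi2 -/Lg -/Cg -/Cw2 /=; lra.
Qed.

End Variance.

Lemma fisher_le e theta w : dotv w (fisher H pol e theta *m w) <= G * sqn w.
Proof.
rewrite /fisher mulmx_suml dotv_sumr.
rewrite (eq_bigr (fun tau : traj S A H => traj_pmf pol e theta tau *
  (H%:R^-1 * \sum_(h < H) dotv w (score pol theta (cur_state tau h) (action tau h)) ^+ 2))); last first.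
  move=> tau _; rewrite -!scalemxAl !dotvZr mulmx_suml dotv_sumr; congr (_ * (_ * _)).
  apply: eq_bigr => h _; rewrite -mulmxA mulmx_dotv.
  set s := score _ _ _ _.
  by rewrite dotvE trmx_mul trmxK mxE big_ord1 -!dotvE (dotvC s) expr2.
apply: pmf_mean_le => tau.
have c0 : 0 <= G * sqn w by rewrite mulr_ge0 ?sqn_ge0.
have [H0|H0] := eqVneq H 0%N; first by rewrite (_ : H%:R^-1 = 0) ?mul0r // H0 invr0.
rewrite ler_pdivrMl ?ltr0n ?lt0n //.
apply: (le_trans (ler_norm _)); apply: norm_sum_ord_le => h.
rewrite ger0_norm ?sqr_ge0 //; apply: (le_trans (cauchy_schwarz2 _ _)).
by rewrite mulrC ler_wpM2r ?sqn_ge0 // -sqn_enorm.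
Qed.

End Bounds.
End Policy.

(** * Finite probability and adaptive sampling *)

Section Pmf.
Variables (R : realType) (X : finType) (d : nat) (p : X -> R).
Hypothesis p_pmf : is_pmf p.
Implicit Types (xi : X -> 'cV[R]_d) (c : 'cV[R]_d).

Lemma mean_sqn_centered xi c : \sum_x p x *: xi x = 0 ->
  \sum_x p x * sqn (c + xi x) = sqn c + \sum_x p x * sqn (xi x).
Proof.
move=> xi0.
rewrite (eq_bigr (fun x => p x * sqn c + (2 * dotv c (p x *: xi x) + p x * sqn (xi x)))); last first.
  by move=> x _; rewrite sqnD dotvZr; ring.
rewrite !big_split /= -mulr_suml p_pmf.2 mul1r -mulr_sumr -dotv_sumr xi0.
by rewrite dotvC dot0v mulr0 add0r.
Qed.

Lemma mean_centered xi : \sum_x p x *: (xi x - \sum_y p y *: xi y) = 0.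
Proof.
rewrite (eq_bigr _ (fun x _ => scalerBr (p x) (xi x) _)) sumrB -scaler_suml.
by rewrite p_pmf.2 scale1r subrr.
Qed.

Lemma mean_sqn_center_le xi :
  \sum_x p x * sqn (xi x - \sum_y p y *: xi y) <= \sum_x p x * sqn (xi x).
Proof.
have := mean_sqn_centered (\sum_y p y *: xi y) (mean_centered xi).
under eq_bigr => x _ do rewrite addrC subrK.
by move->; rewrite lerDr sqn_ge0.
Qed.

Lemma mean_le (f g : X -> R) : (forall x, f x <= g x) ->
  \sum_x p x * f x <= \sum_x p x * g x.
Proof. by move=> fg; apply: ler_sum => x _; rewrite ler_wpM2l ?p_pmf.1. Qed.

End Pmf.

Section ProductPmf.
Variables (R : realType) (I X : finType) (d : nat) (p : I -> X -> R).
Hypothesis p_pmf : forall i, is_pmf (p i).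

Definition prod_pmf (f : {ffun I -> X}) : R := \prod_i p i (f i).

(** Distributivity of the product over the sums.  Choosing [F] constant outside
    one or two indices gives the marginals and the pairwise independence. *)
Lemma mean_prod (F : I -> X -> R) :
  \sum_f prod_pmf f * \prod_i F i (f i) = \prod_i \sum_x p i x * F i x.
Proof.
by rewrite bigA_distr_bigA; apply: eq_bigr => f _; rewrite -big_split.
Qed.

Lemma prod_pmf_is_pmf : is_pmf prod_pmf.
Proof.
split=> [f|]; first by apply: prodr_ge0 => i _; exact: (p_pmf i).1.
transitivity (\sum_f prod_pmf f * \prod_(i : I) (1 : R)).
  by apply: eq_bigr => f _; rewrite big1_eq mulr1.
rewrite (mean_prod (fun _ _ => 1)).
by apply: big1 => i _; rewrite -[RHS](p_pmf i).2; apply: eq_bigr => x _; rewrite mulr1.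
Qed.

Lemma prod_pmf_marginal i (g : X -> R) :
  \sum_f prod_pmf f * g (f i) = \sum_x p i x * g x.
Proof.
have := mean_prod (fun k x => if k == i then g x else 1).
rewrite [RHS](bigD1 i) //= eqxx [X in _ = _ * X]big1 ?mulr1; last first.
  move=> k /negPf ki; rewrite -[RHS](p_pmf k).2; apply: eq_bigr => x _.
  by rewrite ki mulr1.
move=> <-; apply: eq_bigr => f _; congr (_ * _).
by rewrite (bigD1 i) //= eqxx big1 ?mulr1 // => k /negPf ->.
Qed.

Lemma prod_pmf_independent i j (g h : X -> R) : i != j ->
  \sum_f prod_pmf f * (g (f i) * h (f j)) = (\sum_x p i x * g x) * (\sum_x p j x * h x).
Proof.
move=> ij; have ji : j != i by rewrite eq_sym.
have := mean_prod (fun k x => if k == i then g x else if k == j then h x else 1).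
rewrite [RHS](bigD1 i) //= [X in _ * X](bigD1 j) //= (negPf ji) !eqxx.
rewrite [X in _ * (_ * X)]big1 ?mulr1; last first.
  move=> k /andP[/negPf ki /negPf kj]; rewrite -[RHS](p_pmf k).2; apply: eq_bigr => x _.
  by rewrite ki kj mulr1.
move=> <-; apply: eq_bigr => f _; congr (_ * _).
rewrite (bigD1 i) //= [X in _ = _ * X](bigD1 j) //= (negPf ji) !eqxx.
by rewrite [X in _ * (_ * X)]big1 ?mulr1 // => k /andP[/negPf-> /negPf->].
Qed.

(** The cross terms vanish by independence. *)
Lemma mean_sqn_sum_centered (xi : I -> X -> 'cV[R]_d) (c : 'cV[R]_d) :
  (forall i, \sum_x p i x *: xi i x = 0) ->
  \sum_f prod_pmf f * sqn (c + \sum_i xi i (f i)) =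
  sqn c + \sum_i \sum_x p i x * sqn (xi i x).
Proof.
move=> xi0.
have xi0k i k : \sum_x p i x * xi i x k 0 = 0.
  have /colP/(_ k) := xi0 i; rewrite !mxE summxE => e; rewrite -[RHS]e.
  by apply: eq_bigr => x _; rewrite mxE.
rewrite mean_sqn_centered //; last 2 first.
- exact: prod_pmf_is_pmf.
- under eq_bigr => f _ do rewrite scaler_sumr.
  rewrite exchange_big big1 // => i _; apply/colP => k; rewrite summxE mxE.
  rewrite -[RHS](xi0k i k) -[RHS](prod_pmf_marginal i (fun x => xi i x k 0)).
  by apply: eq_bigr => f _; rewrite mxE.
congr (_ + _).
rewrite (eq_bigr (fun f => \sum_i \sum_j \sum_k prod_pmf f * (xi i (f i) k 0 * xi j (f j) k 0))); last first.
  move=> f _; rewrite /sqn dotv_suml mulr_sumr; apply: eq_bigr => i _.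
  rewrite dotv_sumr mulr_sumr; apply: eq_bigr => j _.
  by rewrite mulr_sumr.
rewrite exchange_big /=; apply: eq_bigr => i _.
rewrite exchange_big (bigD1 i) //= [X in _ + X]big1 ?addr0; last first.
  move=> j ji; rewrite exchange_big big1 // => k _.
  by rewrite (prod_pmf_independent (fun x => xi i x k 0) (fun x => xi j x k 0)) 1?eq_sym // xi0k mul0r.
rewrite -(prod_pmf_marginal i (fun x => sqn (xi i x))).
by apply: eq_bigr => f _; rewrite mulr_sumr.
Qed.

End ProductPmf.

Section AdaptiveSampling.
Variables (R : realType) (X : finType) (St : Type).
Variables (q : St -> X -> R) (step : St -> X -> St).
Hypothesis q_pmf : forall s, is_pmf (q s).

(** The law of a sample may depend on all earlier samples, through the state that
    they produced. *)
Definition path_pmf s T (u : T.-tuple X) : R :=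
  \prod_(t < T) q (foldl step s (take t u)) (tnth u t).

Lemma sum_tuple_cons T (F : T.+1.-tuple X -> R) :
  \sum_u F u = \sum_x \sum_(u : T.-tuple X) F [tuple of x :: u].
Proof.
rewrite pair_big /=.
rewrite (reindex (fun p : X * T.-tuple X => [tuple of p.1 :: p.2])) //=.
apply: onW_bij; exists (fun u : T.+1.-tuple X => (thead u, [tuple of behead u])).
- by move=> [x u] /=; rewrite theadE; congr (_, _); exact/val_inj.
- by move=> u /=; rewrite [RHS]tuple_eta.
Qed.

Lemma path_pmf_cons s T x (u : T.-tuple X) :
  path_pmf s [tuple of x :: u] = q s x * path_pmf (step s x) u.
Proof.
rewrite /path_pmf big_ord_recl /= tnth0; congr (_ * _).
by apply: eq_bigr => t _; rewrite tnthS.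
Qed.

Lemma path_pmf_is_pmf s T : is_pmf (@path_pmf s T).
Proof.
split=> [u|]; first by apply: prodr_ge0 => t _; exact: (q_pmf _).1.
elim: T s => [|T IH] s.
  rewrite (big_pred1 [tuple]) ?/path_pmf ?big_ord0 // => u.
  by apply/esym/eqP; exact: tuple0.
rewrite sum_tuple_cons -[RHS](q_pmf s).2; apply: eq_bigr => x _.
under eq_bigr => u _ do rewrite path_pmf_cons.
by rewrite -mulr_sumr IH mulr1.
Qed.

(** Induction on the number of samples, conditioning on the first one.  [Inv]
    restricts the drift condition to reachable states.  There are [T + 1] costs
    for [T] samples: the last one is paid by one more application of the drift
    condition, where the expectation on the left is only known to be
    nonnegative. *)
Lemma lyapunov_bound (Inv : St -> Prop) (Psi cost : St -> R) (K : R) :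
  (forall s x, Inv s -> Inv (step s x)) -> (forall s, 0 <= Psi s) ->
  (forall s, Inv s -> \sum_x q s x * Psi (step s x) <= Psi s - cost s + K) ->
  forall T s, Inv s ->
  \sum_(u : T.-tuple X) path_pmf s u *
    \sum_(t < T.+1) cost (foldl step s (take t u)) <= Psi s + T.+1%:R * K.
Proof.
move=> Inv_step Psi0 drift; elim=> [|T IH] s Is.
  rewrite (big_pred1 [tuple]); last by move=> u; apply/esym/eqP; exact: tuple0.
  rewrite /path_pmf big_ord0 big_ord1 mul1r /= mul1r.
  have := drift s Is; have : 0 <= \sum_x q s x * Psi (step s x).
    by apply: sumr_ge0 => x _; rewrite mulr_ge0 ?(q_pmf s).1.
  by lra.
rewrite sum_tuple_cons.
apply: (@le_trans _ _ (\sum_x q s x * (cost s + (Psi (step s x) + T.+1%:R * K)))).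
  apply: ler_sum => x _.
  under eq_bigr => u _ do rewrite path_pmf_cons big_ord_recl /= -mulrA mulrDr.
  rewrite -mulr_sumr ler_wpM2l ?(q_pmf s).1 // big_split -mulr_suml (path_pmf_is_pmf _ _).2 mul1r.
  by rewrite lerD2l; apply: IH; exact: Inv_step.
rewrite (eq_bigr (fun x => q s x * (cost s + T.+1%:R * K) + q s x * Psi (step s x))); last first.
  by move=> x _; ring.
rewrite big_split -mulr_suml (q_pmf s).2 mul1r /=.
have := drift s Is; rewrite -[T.+2%:R]natr1; lra.
Qed.

End AdaptiveSampling.

(** * Weights of the Lyapunov function *)

Section Weights.
Variables (R : realFieldType) (m kappa beta r L2 Phi q N : R).

(** Each weight is the loss that its quantity causes elsewhere, divided by the
    contraction rate of that quantity: [beta] for momentum errors and [r / 2] for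
    consensus errors.  [drift_weight] collects the coefficients of the squared
    displacement of the parameters in all recursions. *)
Definition mean_err_weight := 4 * kappa / beta.
Definition err_weight := 16 * kappa * beta / r ^+ 2.
Definition track_weight := 4 * kappa / r.
Definition drift_weight :=
  m^-1 * mean_err_weight * (4 * Phi) + err_weight * (4 * Phi) +
  track_weight * (2 / r) * (4 * Phi + 2 * L2).
Definition consensus_weight := 2 / r * (6 * kappa * L2 + 8 * drift_weight).

Hypotheses (m0 : 0 < m) (kappa1 : 1 <= kappa) (beta01 : 0 < beta <= 1)
  (r01 : 0 < r <= 1) (L20 : 0 <= L2) (Phi0 : 0 <= Phi).

Let kappa0 : 0 < kappa.
Proof. by apply: lt_le_trans kappa1. Qed.

Lemma mean_err_weight_ge0 : 0 <= mean_err_weight.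
Proof.
have /andP[b0 _] := beta01.
by rewrite /mean_err_weight divr_ge0 ?mulr_ge0 ?(ltW kappa0) ?(ltW b0).
Qed.

Lemma err_weight_ge0 : 0 <= err_weight.
Proof.
have /andP[b0 _] := beta01; have k0 := ltW kappa0.
by rewrite /err_weight divr_ge0 ?sqr_ge0 // !mulr_ge0 // ltW.
Qed.

Lemma track_weight_ge0 : 0 <= track_weight.
Proof.
have /andP[r0 _] := r01.
by rewrite /track_weight divr_ge0 ?mulr_ge0 ?(ltW kappa0) ?(ltW r0).
Qed.

Lemma drift_weight_ge0 : 0 <= drift_weight.
Proof.
have /andP[r0 _] := r01; have rV : 0 <= r^-1 by rewrite invr_ge0 ltW.
have mV : 0 <= m^-1 by rewrite invr_ge0 ltW.
have P4 : 0 <= 4 * Phi by rewrite mulr_ge0.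
apply: addr_ge0; first apply: addr_ge0.
- exact: mulr_ge0 (mulr_ge0 mV mean_err_weight_ge0) P4.
- exact: mulr_ge0 err_weight_ge0 P4.
- apply: mulr_ge0; first by rewrite mulr_ge0 ?track_weight_ge0 // mulr_ge0.
  by rewrite addr_ge0 ?mulr_ge0.
Qed.

Lemma consensus_weight_ge0 : 0 <= consensus_weight.
Proof.
have /andP[r0 _] := r01; have rV : 0 <= r^-1 by rewrite invr_ge0 ltW.
have k0 := ltW kappa0; have d0 := drift_weight_ge0.
by rewrite /consensus_weight mulr_ge0 ?addr_ge0 ?mulr_ge0.
Qed.

Hypotheses (q0 : 0 <= q) (N_large : 40 * 100 <= N).
Hypotheses (eta_small : N * (L2 + Phi) * kappa ^+ 2 * q <= r ^+ 6)
  (beta_large : N * (L2 + Phi) * kappa ^+ 2 * q <= beta * m * r ^+ 6).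

Let N0 : 0 < N.
Proof. by apply: lt_le_trans N_large; rewrite mulr_gt0. Qed.

(** The left-hand side is the total coefficient of the mean squared tracker that
    the ascent step has to absorb.  The only term that is large for small [beta]
    is [16 * a1], and it is the reason for the lower bound on [beta]. *)
Lemma step_size_absorbs_track :
  consensus_weight * (2 / r) * q + 2 * drift_weight * q <= 1.
Proof.
have /andP[b0 b1] := beta01; have /andP[r0 r1] := r01; have k0 := ltW kappa0.
pose u := kappa * (L2 + Phi) * q.
have u0 : 0 <= u by rewrite !mulr_ge0 ?addr_ge0.
have kP : 0 <= kappa * Phi * q by rewrite !mulr_ge0.
have kL : 0 <= kappa * L2 * q by rewrite !mulr_ge0.
have uE : u = kappa * L2 * q + kappa * Phi * q by rewrite /u; ring.
have u_le : N * u <= N * (L2 + Phi) * kappa ^+ 2 * q.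
  have -> : N * (L2 + Phi) * kappa ^+ 2 * q = N * (kappa * u) by rewrite /u; ring.
  by rewrite ler_pM2l // ler_peMl.
have e1 : N * u <= r ^+ 6 := le_trans u_le eta_small.
have e2 : N * u <= beta * m * r ^+ 6 := le_trans u_le beta_large.
have r2 : 0 < r ^+ 2 by rewrite exprn_gt0.
have r2le : r ^+ 2 <= 1 by rewrite expr_le1 // ltW.
have r4le : r ^+ 4 <= r ^+ 2 by rewrite ler_wiXn2l // ltW.
have r6le : r ^+ 6 <= r ^+ 4 by rewrite ler_wiXn2l // ltW.
have mb : 0 < m * beta by rewrite mulr_gt0.
have div_r2 (x : R) : x <= u -> N * (x / r ^+ 2) <= r ^+ 4.
  move=> xu; rewrite mulrA ler_pdivrMr // -exprD; apply: le_trans e1.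
  by rewrite ler_pM2l.
pose a1 := kappa * Phi * q / (m * beta).
pose a2 := beta * (kappa * Phi * q) / r ^+ 2.
pose a3 := u / r ^+ 2.
pose a4 := kappa * L2 * q / r ^+ 2.
have a1le : N * a1 <= r ^+ 6.
  rewrite /a1 mulrA ler_pdivrMr //; apply: le_trans (_ : N * u <= _).
    by rewrite ler_pM2l // uE lerDr.
  by rewrite [leRHS]mulrC (mulrC m).
have a2le : N * a2 <= r ^+ 4.
  apply: div_r2; apply: (@le_trans _ _ (kappa * Phi * q)); first by rewrite ler_piMl.
  by rewrite uE lerDr.
have a3le : N * a3 <= r ^+ 4 by exact: div_r2.
have a4le : N * a4 <= r ^+ 4 by apply: div_r2; rewrite uE lerDl.
have a40 : 0 <= a4 by rewrite divr_ge0 // ltW.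
have driftE : drift_weight * q = 16 * a1 + 64 * a2 + 32 * a3 - 16 * a4.
  rewrite /drift_weight /mean_err_weight /err_weight /track_weight /a1 /a2 /a3 /a4 /u.
  by field; rewrite !gt_eqF.
have drift_le : N * (drift_weight * q) <= 112 * r ^+ 2.
  have -> : N * (drift_weight * q) =
     16 * (N * a1) + 64 * (N * a2) + 32 * (N * a3) - 16 * (N * a4) by rewrite driftE; ring.
  by have := mulr_ge0 (ltW N0) a40; lra.
have drift_le' : N * (drift_weight * q / r ^+ 2) <= 112 by rewrite mulrA ler_pdivrMr.
have -> : consensus_weight * (2 / r) * q + 2 * drift_weight * q =
    24 * a4 + 32 * (drift_weight * q / r ^+ 2) + 2 * (drift_weight * q).
  by rewrite /consensus_weight /a4; field; rewrite gt_eqF.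
(* In total [N] times the sum is at most [24 + 32 * 112 + 2 * 112 = 3832]. *)
have w1 : N * a4 <= 1 by apply: le_trans a4le (le_trans r4le r2le).
have w3 : N * (drift_weight * q) <= 112 by apply: le_trans drift_le _; lra.
rewrite -(ler_pM2l N0) mulr1; apply: le_trans N_large.
have -> : N * (24 * a4 + 32 * (drift_weight * q / r ^+ 2) + 2 * (drift_weight * q)) =
  24 * (N * a4) + 32 * (N * (drift_weight * q / r ^+ 2)) + 2 * (N * (drift_weight * q)).
  by ring.
move: w1 drift_le' w3; move: (N * a4) (N * _) (N * _) => a b c; lra.
Qed.

(** Applied to [x = G * L * eta / mu ^+ 2], the relative size of the second-order
    term in the ascent step. *)
Lemma step_size_absorbs_curvature (x : R) : 0 <= x -> x ^+ 2 = L2 * kappa ^+ 2 * q -> x <= 1 / 2.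
Proof.
have /andP[r0 r1] := r01; have k0 := ltW kappa0; move=> x0 xE.
have r6 : r ^+ 6 <= 1 by rewrite expr_le1 // ltW.
have h1 : 0 <= Phi * kappa ^+ 2 * q by rewrite !mulr_ge0 ?sqr_ge0.
have h2 : N * (L2 + Phi) * kappa ^+ 2 * q = N * (x ^+ 2 + Phi * kappa ^+ 2 * q).
  by rewrite xE; ring.
have h3 : N * x ^+ 2 <= 1.
  apply: le_trans (le_trans eta_small r6); rewrite h2 ler_pM2l //.
  by rewrite lerDl.
have N4 : 4 <= N by apply: le_trans N_large; rewrite -natrM ler_nat.
have h4 := ler_wpM2r (sqr_ge0 x) N4.
rewrite -(ler_pXn2r (ltn0Sn 1)) ?nnegrE ?divr_ge0 //.
have -> : (1 / 2) ^+ 2 = 1 / 4 :> R by field.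
lra.
Qed.

End Weights.

(** * One iteration of the algorithm *)

Section Drift.
Variables (R : realType) (S A : finType) (n d H : nat) (gamma : R).
Variable pol : 'cV[R]_d -> S -> A -> R.
Variables (envs : 'I_n -> environment R S A) (b : 'I_n -> R) (W : 'M[R]_n).
Variables (eta beta mu G L Phi : R) (nu : 'I_n -> R).
Variable vgrad : 'I_n -> 'cV[R]_d -> 'cV[R]_d.

Local Notation traj := (traj S A H).
Local Notation p i := (@traj_pmf R S A d H pol (envs i)).
Local Notation g i := (@grad_est R S A d H gamma pol (envs i) (b i)).
Local Notation precond i x := (invmx (fisher H pol (envs i) x)).
Local Notation state := (state R n d).
Local Notation next_param := (next_param H pol envs W eta).
Local Notation step := (@step R S A n d H gamma pol envs b W eta beta).
Let ones : 'cV[R]_n := const_mx 1.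
Let rho := specnorm (W - n%:R^-1 *: (ones *m ones^T)).
Let r := 1 - rho ^+ 2.
Let nubar2 := n%:R^-1 * \sum_(i < n) nu i ^+ 2.
Definition mgrad (x : 'cV[R]_d) : 'cV[R]_d := mean (fun i => vgrad i x).

Hypothesis n0 : (0 < n)%N.
Hypotheses (W_row : W *m ones = ones) (W_col : ones^T *m W = ones^T)
  (W_ge0 : forall i j, 0 <= W i j) (rho01 : 0 <= rho < 1).
Hypotheses (eta0 : 0 < eta) (beta01 : 0 < beta <= 1) (mu0 : 0 < mu) (G0 : 0 < G)
  (L0 : 0 <= L) (Phi0 : 0 <= Phi).
Hypotheses
  (p_pmf : forall i x, is_pmf (p i x))
  (unbiased : forall i x, \sum_tau p i x tau *: g i tau x = vgrad i x)
  (weighted_unbiased : forall i x y,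
    \sum_tau p i x tau *: (is_weight pol tau y x *: g i tau y) = vgrad i y)
  (variance_le : forall i x,
    \sum_tau p i x tau * sqn (g i tau x - vgrad i x) <= nu i ^+ 2)
  (difference_le : forall i x y, \sum_tau p i x tau *
    sqn (g i tau x - is_weight pol tau y x *: g i tau y) <= 2 * Phi * sqn (y - x))
  (vgrad_lip : forall i x y, sqn (vgrad i y - vgrad i x) <= L ^+ 2 * sqn (y - x))
  (precond_norm : forall i x y, mu ^+ 2 * sqn (precond i x *m y) <= sqn y)
  (precond_asc : forall i z x y,
    (2 * G)^-1 * (sqn x + sqn y) - (2 * mu)^-1 * sqn (y - x) <=
    dotv x (precond i z *m y)).

Implicit Types (st : state) (tau : {ffun 'I_n -> traj}).

Let r01 : 0 < r <= 1.
Proof.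
have /andP[h0 h1] := rho01; rewrite /r subr_gt0 expr_lt1 // h1 /=.
by rewrite lerBlDr lerDl sqr_ge0.
Qed.

Let nR : 0 < n%:R :> R.
Proof. by rewrite ltr0n. Qed.

(** Young's inequality with [c = r / 2] turns the factor [rho ^+ 2 = 1 - r] into
    [1 - r / 2] on the old deviation, at the price [2 / r] on the perturbation. *)
Lemma dev_mix_contraction (x z : 'I_n -> 'cV[R]_d) :
  msqn (dev (mix W (fun i => x i + z i))) <= (1 - r / 2) * msqn (dev x) + 2 / r * msqn z.
Proof.
have /andP[r0 r1] := r01.
apply: le_trans (msqn_dev_mix_le n0 W_row W_col _ (mean x)) _; rewrite -/rho.
rewrite (eq_msqn (y := fun i => dev x i + z i)); last by move=> i; rewrite addrAC.
have rh : rho ^+ 2 = 1 - r by rewrite /r; ring.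
have r2 : 0 < r / 2 by rewrite divr_gt0.
apply: le_trans (ler_wpM2l (sqr_ge0 rho) (msqnD_young n0 (dev x) z r2)) _.
rewrite rh mulrDr !(mulrA (1 - r)); apply: lerD; apply: ler_wpM2r; rewrite ?msqn_ge0 //.
  have := mulr_ge0 (ltW r0) (ltW r0); lra.
have -> : (1 - r) * (1 + (r / 2)^-1) = 2 / r - (r + 1).
  by field; rewrite gt_eqF.
lra.
Qed.

Section Deterministic.
Variable st : state.

Let direction i := eta *: (precond i (param st i) *m track st i).

Lemma msqn_direction_le : msqn direction <= eta ^+ 2 / mu ^+ 2 * msqn (track st).
Proof.
rewrite (msqnZ eta) -mulrA ler_wpM2l ?sqr_ge0 // -ler_pdivrMl; last by rewrite invr_gt0 exprn_gt0.
rewrite invrK /msqn mulrCA ler_pM2l ?invr_gt0 // mulr_sumr.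
by apply: ler_sum => i _; exact: precond_norm.
Qed.

Lemma next_paramE : next_param st = mix W (fun i => param st i + direction i).
Proof. by []. Qed.

Lemma mean_next_param : mean (next_param st) = mean (param st) + mean direction.
Proof. by rewrite next_paramE mean_mix // meanD. Qed.

Lemma consensus_error_next :
  msqn (dev (next_param st)) <=
  (1 - r / 2) * msqn (dev (param st)) + 2 / r * (eta ^+ 2 / mu ^+ 2 * msqn (track st)).
Proof.
have /andP[r0 _] := r01.
apply: le_trans (dev_mix_contraction _ _) _; rewrite lerD2l ler_wpM2l ?msqn_direction_le //.
by rewrite divr_ge0 ?ltW.
Qed.

(** The displacement is the mixed deviation minus the deviation plus the mixed
    update direction: averages common to all agents cancel. *)
Lemma param_drift_le :
  msqn (fun i => next_param st i - param st i) <=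
  8 * msqn (dev (param st)) + 2 * (eta ^+ 2 / mu ^+ 2 * msqn (track st)).
Proof.
have e i : next_param st i - param st i =
    (mix W (dev (param st)) i + - dev (param st) i) + mix W direction i.
  by rewrite next_paramE mixD mixB_cst // /dev; apply/colP => k; rewrite !mxE; ring.
rewrite (eq_msqn e); apply: le_trans (msqnD_le _ _ _) _ => //.
apply: lerD; last first.
  by rewrite ler_pM2l //; apply: le_trans (msqn_mix_le _ _ _ _ _) _ => //; exact: msqn_direction_le.
apply: (@le_trans _ _ (2 * (2 * msqn (mix W (dev (param st))) + 2 * msqn (fun i => - dev (param st) i)))).
  by rewrite ler_pM2l //; exact: msqnD_le.
have -> : msqn (fun i => - dev (param st) i) = msqn (dev (param st)).
  by rewrite /msqn; congr (_ * _); apply: eq_bigr => i _; rewrite sqnN.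
have := msqn_mix_le n0 W_row W_col W_ge0 (dev (param st)); lra.
Qed.

End Deterministic.

Section Noise.
Variables (i : 'I_n) (x' x : 'cV[R]_d).

(** The part of the momentum update that is centered given the past. *)
Definition noise (tau : traj) : 'cV[R]_d :=
  beta *: (g i tau x' - vgrad i x') +
  (1 - beta) *: (g i tau x' - is_weight pol tau x x' *: g i tau x
                 - (vgrad i x' - vgrad i x)).

Lemma difference_mean : \sum_tau p i x' tau *:
  (g i tau x' - is_weight pol tau x x' *: g i tau x) = vgrad i x' - vgrad i x.
Proof.
rewrite (eq_bigr _ (fun t _ => scalerBr (p i x' t) _ _)) sumrB.
by rewrite unbiased weighted_unbiased.
Qed.

Lemma noise_centered : \sum_tau p i x' tau *: noise tau = 0.
Proof.
have h1 : \sum_tau p i x' tau *: (g i tau x' - vgrad i x') = 0.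
  by rewrite -(unbiased i x') mean_centered.
have h2 : \sum_tau p i x' tau *: (g i tau x' - is_weight pol tau x x' *: g i tau x
                 - (vgrad i x' - vgrad i x)) = 0.
  by rewrite -difference_mean mean_centered.
rewrite (eq_bigr (fun t => beta *: (p i x' t *: (g i t x' - vgrad i x')) +
  (1 - beta) *: (p i x' t *: (g i t x' - is_weight pol t x x' *: g i t x
                 - (vgrad i x' - vgrad i x))))); last first.
  by move=> t _; rewrite scalerDr !scalerA (mulrC beta) (mulrC (1 - beta)).
by rewrite big_split /= -!scaler_sumr h1 h2 !scaler0 addr0.
Qed.

Lemma noise_second_moment : \sum_tau p i x' tau * sqn (noise tau) <=
  2 * beta ^+ 2 * nu i ^+ 2 + 4 * Phi * sqn (x' - x).
Proof.
have /andP[b0 b1] := beta01.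
pose D t := g i t x' - is_weight pol t x x' *: g i t x.
have hD : \sum_t p i x' t * sqn (D t - (vgrad i x' - vgrad i x)) <= 2 * Phi * sqn (x' - x).
  rewrite -difference_mean -/D -(sqnN (x' - x)) opprB.
  apply: le_trans (difference_le i x' x).
  exact: mean_sqn_center_le.
apply: (@le_trans _ _ (\sum_t (2 * beta ^+ 2 * (p i x' t * sqn (g i t x' - vgrad i x')) +
  2 * (1 - beta) ^+ 2 * (p i x' t * sqn (D t - (vgrad i x' - vgrad i x)))))).
  apply: ler_sum => t _; rewrite !(mulrCA (2 * _)) -mulrDr ler_wpM2l ?(p_pmf i x').1 //.
  by apply: le_trans (sqnD_le _ _) _; rewrite !sqnZ !mulrA.
rewrite big_split -!mulr_sumr; apply: lerD.
  by rewrite ler_wpM2l // mulr_ge0 // sqr_ge0.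
have c1 : (1 - beta) ^+ 2 <= 1 by rewrite expr_le1 //; lra.
have c0 : 0 <= Phi * sqn (x' - x) by rewrite mulr_ge0 ?sqn_ge0.
apply: le_trans (ler_wpM2l _ hD) _; first by rewrite mulr_ge0 // sqr_ge0.
have := ler_wpM2r c0 c1; lra.
Qed.

End Noise.

Definition err st i := mom st i - vgrad i (param st i).

(** The gradient difference estimated in the update tracks the moving target, so
    that the old error is carried over with the factor [1 - beta] only. *)
Lemma err_step st tau i : err (step st tau) i =
  (1 - beta) *: err st i + noise i (next_param st i) (param st i) (tau i).
Proof.
rewrite /err /noise /=; set om := is_weight _ _ _ _.
by apply/colP => k; rewrite !mxE; ring.
Qed.

Lemma mom_increment st tau i : mom (step st tau) i - mom st i =
  (vgrad i (next_param st i) - vgrad i (param st i) - beta *: err st i) +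
  noise i (next_param st i) (param st i) (tau i).
Proof.
rewrite /err /noise /=; set om := is_weight _ _ _ _.
by apply/colP => k; rewrite !mxE; ring.
Qed.

Definition step_pmf st : {ffun 'I_n -> traj} -> R := prod_pmf (fun i => p i (next_param st i)).

Lemma step_pmf_is_pmf st : is_pmf (step_pmf st).
Proof. by apply: prod_pmf_is_pmf => i. Qed.

Definition drift2 st := msqn (fun i => next_param st i - param st i).

Let noise_power st := n%:R^-1 * \sum_i \sum_t p i (next_param st i) t *
  sqn (noise i (next_param st i) (param st i) t).

Lemma noise_power_le st : noise_power st <= 2 * beta ^+ 2 * nubar2 + 4 * Phi * drift2 st.
Proof.
rewrite /nubar2 /drift2 /msqn !(mulrCA (_ * _)) -mulrDr ler_pM2l ?invr_gt0 //.
rewrite !mulr_sumr -big_split; apply: ler_sum => i _; exact: noise_second_moment.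
Qed.

Lemma mean_msqn_centered st (c : 'I_n -> 'cV[R]_d) :
  \sum_tau step_pmf st tau * msqn (fun i => c i + noise i (next_param st i) (param st i) (tau i))
  = msqn c + noise_power st.
Proof.
rewrite (eq_bigr (fun tau => n%:R^-1 * \sum_i step_pmf st tau *
   sqn (c i + noise i (next_param st i) (param st i) (tau i)))); last first.
  by move=> tau _; rewrite /msqn mulrCA mulr_sumr.
rewrite -mulr_sumr /msqn /noise_power -mulrDr -big_split; congr (_ * _).
rewrite exchange_big; apply: eq_bigr => i _ /=.
rewrite (prod_pmf_marginal _ i (fun t => sqn (c i + noise i (next_param st i) (param st i) t))) //.
by apply: mean_sqn_centered => //; exact: noise_centered.
Qed.

Lemma sqr_onem_le : (1 - beta) ^+ 2 <= 1 - beta.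
Proof. by have /andP[b0 b1] := beta01; rewrite expr2 ler_piMl //; lra. Qed.

Lemma err_step_second_moment st :
  \sum_tau step_pmf st tau * msqn (err (step st tau)) <=
  (1 - beta) * msqn (err st) + 2 * beta ^+ 2 * nubar2 + 4 * Phi * drift2 st.
Proof.
under eq_bigr => tau _ do rewrite (eq_msqn (err_step st tau)).
rewrite mean_msqn_centered -addrA lerD ?noise_power_le // msqnZ.
by rewrite ler_wpM2r ?msqn_ge0 ?sqr_onem_le.
Qed.

(** Independence across agents gives the factor [n%:R^-1] on the noise. *)
Lemma mean_err_step_second_moment st :
  \sum_tau step_pmf st tau * sqn (mean (err (step st tau))) <=
  (1 - beta) * sqn (mean (err st)) + n%:R^-1 * (2 * beta ^+ 2 * nubar2 + 4 * Phi * drift2 st).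
Proof.
have e tau : mean (err (step st tau)) = (1 - beta) *: mean (err st) +
  \sum_i n%:R^-1 *: noise i (next_param st i) (param st i) (tau i).
  rewrite (eq_mean (err_step st tau)) meanD; congr (_ + _); first by rewrite meanZ.
  by rewrite /mean scaler_sumr.
under eq_bigr => tau _ do rewrite e.
rewrite (mean_sqn_sum_centered (fun i => p_pmf i (next_param st i))
  (xi := fun i t => n%:R^-1 *: noise i (next_param st i) (param st i) t)) //; last first.
  move=> i; transitivity (n%:R^-1 *: \sum_t p i (next_param st i) t *: noise i (next_param st i) (param st i) t).
    by rewrite scaler_sumr; apply: eq_bigr => t _; rewrite !scalerA mulrC.
  by rewrite noise_centered scaler0.
apply: lerD; first by rewrite sqnZ ler_wpM2r ?sqn_ge0 ?sqr_onem_le.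
apply: le_trans (ler_wpM2l _ (noise_power_le st)); last by rewrite invr_ge0 ltW.
rewrite /noise_power mulrA -expr2 mulr_sumr; apply: ler_sum => i _.
rewrite mulr_sumr; apply: ler_sum => t _.
by rewrite sqnZ mulrCA.
Qed.

Lemma mom_increment_second_moment st :
  \sum_tau step_pmf st tau * msqn (fun i => mom (step st tau) i - mom st i) <=
  2 * beta ^+ 2 * msqn (err st) + 2 * beta ^+ 2 * nubar2 + (4 * Phi + 2 * L ^+ 2) * drift2 st.
Proof.
under eq_bigr => tau _ do rewrite (eq_msqn (mom_increment st tau)).
rewrite mean_msqn_centered.
have h1 := msqnD_le n0 (fun i => vgrad i (next_param st i) - vgrad i (param st i)) (fun i => - (beta *: err st i)).
have e : msqn (fun i => - (beta *: err st i)) = beta ^+ 2 * msqn (err st).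
  by rewrite -msqnZ /msqn; congr (_ * _); apply: eq_bigr => i _; rewrite sqnN.
have h2 : msqn (fun i => vgrad i (next_param st i) - vgrad i (param st i)) <= L ^+ 2 * drift2 st.
  rewrite /drift2 /msqn mulrCA ler_pM2l ?invr_gt0 // mulr_sumr.
  by apply: ler_sum => i _; exact: vgrad_lip.
have := noise_power_le st; rewrite e in h1; lra.
Qed.

Lemma tracking_error_step st :
  \sum_tau step_pmf st tau * msqn (dev (track (step st tau))) <=
  (1 - r / 2) * msqn (dev (track st)) + 2 / r *
  (2 * beta ^+ 2 * msqn (err st) + 2 * beta ^+ 2 * nubar2 + (4 * Phi + 2 * L ^+ 2) * drift2 st).
Proof.
have /andP[r0 _] := r01.
apply: (@le_trans _ _ (\sum_tau (step_pmf st tau * ((1 - r / 2) * msqn (dev (track st))) +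
   2 / r * (step_pmf st tau * msqn (fun i => mom (step st tau) i - mom st i))))).
  apply: ler_sum => tau _; rewrite [X in _ + X]mulrCA -mulrDr ler_wpM2l ?(step_pmf_is_pmf st).1 //.
  have -> : track (step st tau) = mix W (fun i => track st i + (mom (step st tau) i - mom st i)).
    apply/funext => i; rewrite /= /track_update /mix; apply: eq_bigr => j _.
    by congr (_ *: _); exact/esym/addrA.
  exact: dev_mix_contraction.
rewrite big_split -mulr_suml (step_pmf_is_pmf st).2 mul1r -mulr_sumr lerD2l.
by rewrite ler_wpM2l ?mom_increment_second_moment // divr_ge0 ?ltW.
Qed.

(** The tracking invariant: with a doubly stochastic matrix, the average of the
    trackers is always the average of the momenta. *)
Definition tracked st := mean (track st) = mean (mom st).

Lemma tracked_step st tau : tracked st -> tracked (step st tau).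
Proof.
rewrite /tracked => h; rewrite /= /track_update mean_mix // meanB meanD h.
by rewrite addrAC subrr add0r.
Qed.

(** * Ascent and the Lyapunov drift *)

Variables (V : 'cV[R]_d -> R) (Vstar : R).
Hypotheses
  (V_smooth : forall x u, V x + dotv (mgrad x) u - L / 2 * sqn u <= V (x + u))
  (V_le : forall x, V x <= Vstar).

Let kappa := G / mu.
Let q := eta ^+ 2 / mu ^+ 2.
Hypothesis (kappa1 : 1 <= kappa).
Variable N : R.
Hypotheses (N_large : 40 * 100 <= N)
  (eta_small : N * (L ^+ 2 + Phi) * kappa ^+ 2 * q <= r ^+ 6)
  (beta_large : N * (L ^+ 2 + Phi) * kappa ^+ 2 * q <= beta * n%:R * r ^+ 6).

Let consensus st := msqn (dev (param st)).
Let cost st := msqn (fun i => mgrad (param st i)).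

Lemma mgrad_lip x y : sqn (mgrad y - mgrad x) <= L ^+ 2 * sqn (y - x).
Proof.
rewrite /mgrad -meanB; apply: le_trans (sqn_mean_le n0 _) _.
rewrite -sqnZ -(msqn_cst n0 (L *: (y - x))).
rewrite /msqn ler_pM2l ?invr_gt0 //; apply: ler_sum => i _.
by rewrite sqnZ vgrad_lip.
Qed.

Lemma cost_le st : cost st <= 2 * sqn (mgrad (mean (param st))) + 2 * L ^+ 2 * consensus st.
Proof.
set a := mgrad (mean (param st)).
have e i : mgrad (param st i) = a + (mgrad (param st i) - a) by rewrite addrC subrK.
rewrite /cost (eq_msqn e); apply: le_trans (msqnD_le n0 _ _) _.
rewrite msqn_cst // lerD2l -mulrA ler_pM2l // /msqn /consensus /msqn [leRHS]mulrCA ler_pM2l ?invr_gt0 //.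
by rewrite mulr_sumr; apply: ler_sum => i _; exact: mgrad_lip.
Qed.

(** Bias-variance decomposition around the average tracker, which is the average
    momentum. *)
Lemma tracked_gradient_error st : tracked st ->
  msqn (fun i => track st i - mgrad (mean (param st))) <=
  msqn (dev (track st)) + 2 * sqn (mean (err st)) + 2 * L ^+ 2 * consensus st.
Proof.
move=> trk; rewrite (msqn_bias_variance n0) trk -addrA lerD2l.
set a := mgrad _.
have -> : mean (mom st) - a = mean (err st) + mean (fun i => vgrad i (param st i) - vgrad i (mean (param st))).
  rewrite /err !meanB -/(mgrad _) -/a; by rewrite addrA subrK.
apply: le_trans (sqnD_le _ _) _; rewrite lerD2l -mulrA ler_pM2l //.
apply: le_trans (sqn_mean_le n0 _) _.
rewrite /consensus /msqn mulrCA ler_pM2l ?invr_gt0 // mulr_sumr.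
by apply: ler_sum => i _; exact: vgrad_lip.
Qed.

Lemma value_ascent st : tracked st ->
  V (mean (param st)) + eta / (2 * G) * (sqn (mgrad (mean (param st))) + msqn (track st))
  - eta / (2 * mu) * (msqn (dev (track st)) + 2 * sqn (mean (err st)) + 2 * L ^+ 2 * consensus st)
  - L / 2 * (q * msqn (track st)) <= V (mean (next_param st)).
Proof.
move=> trk; rewrite mean_next_param.
set dir := fun i => eta *: _; set a := mgrad (mean (param st)).
apply: le_trans (V_smooth _ _).
have h1 : sqn (mean dir) <= q * msqn (track st).
  by apply: le_trans (sqn_mean_le n0 _) _; exact: msqn_direction_le.
have h2 : eta / (2 * G) * (sqn a + msqn (track st)) - eta / (2 * mu) * msqn (fun i => track st i - a)
    <= dotv a (mean dir).
  rewrite /mean dotvZr dotv_sumr.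
  apply: (@le_trans _ _ (n%:R^-1 * \sum_i eta * ((2 * G)^-1 * (sqn a + sqn (track st i)) - (2 * mu)^-1 * sqn (track st i - a)))).
    have sa : n%:R^-1 * \sum_(i < n) sqn a = sqn a by exact: (msqn_cst n0 a).
    rewrite -mulr_sumr sumrB -!mulr_sumr big_split /= /msqn -{1}sa.
    by apply: le_of_eq; ring.
  rewrite ler_pM2l ?invr_gt0 //; apply: ler_sum => i _; by rewrite dotvZr ler_pM2l.
have h3 := tracked_gradient_error trk; rewrite -/a in h3.
have c1 : 0 <= eta / (2 * mu) by rewrite divr_ge0 ?mulr_ge0 ?ltW.
have c2 : 0 <= L / 2 by rewrite divr_ge0.
have := ler_wpM2l c1 h3; have := ler_wpM2l c2 h1; rewrite -/a; lra.
Qed.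

Let c1 := mean_err_weight kappa beta.
Let c2 := err_weight kappa beta r.
Let c4 := track_weight kappa r.
Let cD := drift_weight n%:R kappa beta r (L ^+ 2) Phi.
Let c3 := consensus_weight n%:R kappa beta r (L ^+ 2) Phi.

(** The gap is scaled by [4 * G / eta] so that the ascent step gains exactly twice
    the squared gradient at the average parameter. *)
Definition lyapunov st : R :=
  4 * G / eta * (Vstar - V (mean (param st))) + c1 * sqn (mean (err st)) +
  c2 * msqn (err st) + c3 * consensus st + c4 * msqn (dev (track st)).

Let c1_ge0 : 0 <= c1.
Proof. exact: mean_err_weight_ge0. Qed.

Let c2_ge0 : 0 <= c2.
Proof. exact: err_weight_ge0. Qed.

Let c4_ge0 : 0 <= c4.
Proof. exact: track_weight_ge0. Qed.

Let cD_ge0 : 0 <= cD.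
Proof. by apply: drift_weight_ge0; rewrite ?sqr_ge0. Qed.

Let c3_ge0 : 0 <= c3.
Proof. by apply: consensus_weight_ge0; rewrite ?sqr_ge0. Qed.

Lemma lyapunov_ge0 st : 0 <= lyapunov st.
Proof.
rewrite /lyapunov !addr_ge0 // mulr_ge0 ?msqn_ge0 ?sqn_ge0 ?subr_ge0 //.
by rewrite divr_ge0 ?mulr_ge0 ?ltW.
Qed.

Let q_ge0 : 0 <= q.
Proof. by rewrite /q divr_ge0 ?sqr_ge0. Qed.

Let track_coefficient_le : c3 * (2 / r) * q + 2 * cD * q <= 1.
Proof. by apply: (step_size_absorbs_track (N := N)); rewrite ?sqr_ge0. Qed.

Let curvature_small : G * L * eta / mu ^+ 2 <= 1 / 2.
Proof.
apply: (step_size_absorbs_curvature (L2 := L ^+ 2) (kappa := kappa) (r := r)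
  (Phi := Phi) (q := q) (N := N)) => //.
  by rewrite divr_ge0 ?sqr_ge0 // !mulr_ge0 // ltW.
by rewrite /kappa /q; field; rewrite gt_eqF.
Qed.

Definition noise_floor : R :=
  (n%:R^-1 * c1 + c2 + c4 * (2 / r)) * (2 * beta ^+ 2 * nubar2).

(** The recursions are added with their weights.  By the choice of the
    weights the terms in the momentum and consensus errors cancel or are
    nonpositive ([k1] to [k5] below), and so is the coefficient of the mean
    squared tracker. *)
Lemma lyapunov_drift st : tracked st ->
  \sum_tau step_pmf st tau * lyapunov (step st tau) <= lyapunov st - cost st + noise_floor.
Proof.
move=> trk; have /andP[b0 b1] := beta01; have /andP[r0 r1] := r01.
pose Vn := V (mean (next_param st)).
have -> : \sum_tau step_pmf st tau * lyapunov (step st tau) =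
   4 * G / eta * (Vstar - Vn) + c3 * msqn (dev (next_param st)) +
   c1 * (\sum_tau step_pmf st tau * sqn (mean (err (step st tau)))) +
   c2 * (\sum_tau step_pmf st tau * msqn (err (step st tau))) +
   c4 * (\sum_tau step_pmf st tau * msqn (dev (track (step st tau)))).
  rewrite -[4 * G / eta * (Vstar - Vn) + c3 * _]mul1r -{1}(step_pmf_is_pmf st).2 mulr_suml !mulr_sumr -!big_split.
  by apply: eq_bigr => tau _; rewrite /lyapunov /consensus /Vn /=; ring.
have hE := ler_wpM2l c1_ge0 (mean_err_step_second_moment st).
have hEe := ler_wpM2l c2_ge0 (err_step_second_moment st).
have hY := ler_wpM2l c4_ge0 (tracking_error_step st).
have hX := ler_wpM2l c3_ge0 (consensus_error_next st).
have hD := ler_wpM2l cD_ge0 (param_drift_le st).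
rewrite -/(drift2 st) in hD.
have a0 : 0 <= 4 * G / eta by rewrite divr_ge0 ?mulr_ge0 ?ltW.
have hV := ler_wpM2l a0 (value_ascent trk); rewrite -/Vn in hV.
have hC := cost_le st.
have hT := ler_wpM2r (msqn_ge0 n0 (track st)) track_coefficient_le.
have hL := ler_wpM2r (msqn_ge0 n0 (track st)) curvature_small.
rewrite -/q -/(consensus st) in hX hD hV hC hT hL.
move: hE hEe hY hX hD hV hC hT hL.
set Ybar := msqn (track st); set Ng := sqn (mgrad _); set Eb := sqn (mean (err st)); set Ee := msqn (err st).
set Yp := msqn (dev (track st)); set X := consensus st; set D := drift2 st.
set Eb' := \sum_tau _; set Ee' := \sum_tau _; set Yp' := \sum_tau _; set X' := msqn _.
move=> hE hEe hY hX hD hV hC hT hL.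
have Eb0 : 0 <= Eb by exact: sqn_ge0.
have X0 : 0 <= X by exact: msqn_ge0.
have k1 : c1 * beta * Eb = 4 * kappa * Eb by rewrite /c1 /mean_err_weight; field; rewrite gt_eqF.
have k2 : c2 * beta * Ee = c4 * (2 / r) * (2 * beta ^+ 2) * Ee.
  by rewrite /c2 /c4 /err_weight /track_weight; field; rewrite gt_eqF.
have k3 : c3 * (r / 2) * X = (6 * kappa * L ^+ 2 + 8 * cD) * X.
  by rewrite /c3 /consensus_weight -/cD; field; rewrite gt_eqF.
have k4 : c4 * (r / 2) * Yp = 2 * kappa * Yp by rewrite /c4 /track_weight; field; rewrite gt_eqF.
have k5 : 2 * L ^+ 2 * X <= 2 * kappa * L ^+ 2 * X.
  have : 0 <= L ^+ 2 * X by rewrite mulr_ge0 ?sqr_ge0.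
  by move/(ler_wpM2r) => /(_ _ _ kappa1); lra.
have kD : cD * D = n%:R^-1 * c1 * (4 * Phi) * D + c2 * (4 * Phi) * D +
    c4 * (2 / r) * (4 * Phi + 2 * L ^+ 2) * D by rewrite /cD /drift_weight -/c1 -/c2 -/c4; ring.
have {}hV : 4 * G / eta * (Vstar - Vn) <= 4 * G / eta * (Vstar - V (mean (param st)))
   - 2 * (Ng + Ybar) + 2 * kappa * (Yp + 2 * Eb + 2 * L ^+ 2 * X) + 2 * (G * L * eta / mu ^+ 2 * Ybar).
  have m1 : 4 * G / eta * (eta / (2 * G) * (Ng + Ybar)) = 2 * (Ng + Ybar).
    by field; rewrite !gt_eqF.
  have m2 : 4 * G / eta * (eta / (2 * mu) * (Yp + 2 * Eb + 2 * L ^+ 2 * X)) =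
     2 * kappa * (Yp + 2 * Eb + 2 * L ^+ 2 * X).
    by rewrite /kappa; field; rewrite !gt_eqF.
  have m3 : 4 * G / eta * (L / 2 * (q * Ybar)) = 2 * (G * L * eta / mu ^+ 2 * Ybar).
    by rewrite /q; field; rewrite !gt_eqF.
  by move: hV; rewrite !mulrBr mulrDr m1 m2 m3; lra.
have Yb0 : 0 <= Ybar by exact: msqn_ge0.
rewrite /lyapunov -/Eb -/Ee -/X -/Yp /noise_floor.
lra.
Qed.

(** * Initial batch and the whole run *)

Variables (T B : nat) (theta0 : 'cV[R]_d).
Hypothesis B0 : (0 < B)%N.

Local Notation init := (@init_state R S A n d H gamma pol envs b W B theta0).
Local Notation batch_space := {ffun 'I_n * 'I_B -> traj}.
Implicit Type bt : batch_space.

Definition batch_pmf : batch_space -> R := prod_pmf (fun ik => p ik.1 theta0).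

Lemma batch_pmf_is_pmf : is_pmf batch_pmf.
Proof. by apply: prod_pmf_is_pmf => ik. Qed.

Let sample_noise (ik : 'I_n * 'I_B) (t : traj) := g ik.1 t theta0 - vgrad ik.1 theta0.

Let BR : 0 < B%:R :> R.
Proof. by rewrite ltr0n. Qed.

(** Weights [a] that depend on the agent only cover both the error of a single
    agent and the error of the network average. *)
Lemma batch_second_moment (a : 'I_n -> R) (c : 'cV[R]_d) :
  \sum_bt batch_pmf bt * sqn (c + \sum_ik a ik.1 *: sample_noise ik (bt ik)) <=
  sqn c + \sum_i B%:R * (a i ^+ 2 * nu i ^+ 2).
Proof.
rewrite (mean_sqn_sum_centered (fun ik => p_pmf ik.1 theta0)
  (xi := fun ik t => a ik.1 *: sample_noise ik t)); last first.
  move=> ik; transitivity (a ik.1 *: \sum_t p ik.1 theta0 t *: sample_noise ik t).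
    by rewrite scaler_sumr; apply: eq_bigr => t _; rewrite !scalerA mulrC.
  by rewrite /sample_noise -(unbiased ik.1 theta0) mean_centered // scaler0.
rewrite lerD2l.
apply: (@le_trans _ _ (\sum_(ik : 'I_n * 'I_B) a ik.1 ^+ 2 * nu ik.1 ^+ 2)).
  apply: ler_sum => ik _.
  apply: le_trans (ler_wpM2l (sqr_ge0 (a ik.1)) (variance_le ik.1 theta0)).
  by rewrite mulr_sumr; apply: ler_sum => t _; rewrite sqnZ mulrCA.
rewrite -(pair_bigA _ (fun i (k : 'I_B) => a i ^+ 2 * nu i ^+ 2)) /=.
by apply: ler_sum => i _; rewrite sumr_const card_ord mulr_natl.
Qed.

(* The error of the momentum of agent [i] is a weighted sum over the samples of
   all agents, with weights [own i]. *)
Let own (i j : 'I_n) : R := if j == i then B%:R^-1 else 0.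

Let own_noise bt i : \sum_ik own i ik.1 *: sample_noise ik (bt ik) = err (init bt) i.
Proof.
transitivity (\sum_j \sum_k own i j *: sample_noise (j, k) (bt (j, k))).
  by rewrite pair_bigA; apply: eq_bigr => -[].
rewrite (bigD1 i) //= [X in _ + X]big1 ?addr0; last first.
  by move=> j /negPf ji; rewrite big1 // => k _; rewrite /own ji scale0r.
rewrite -scaler_sumr /own eqxx /sample_noise /= sumrB scalerBr sumr_const card_ord.
rewrite -(scaler_nat B (vgrad i theta0)) scalerA mulVf ?scale1r ?gt_eqF //.
Qed.

Let own_power i : \sum_j B%:R * (own i j ^+ 2 * nu j ^+ 2) = B%:R^-1 * nu i ^+ 2.
Proof.
rewrite (bigD1 i) //= [X in _ + X]big1 ?addr0; last first.
  by move=> j /negPf ji; rewrite /own ji expr0n mul0r mulr0.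
by rewrite /own eqxx; field; rewrite gt_eqF.
Qed.

Lemma init_second_moment (c : 'I_n -> 'cV[R]_d) :
  \sum_bt batch_pmf bt * msqn (fun i => c i + err (init bt) i) <= msqn c + nubar2 / B%:R.
Proof.
rewrite (eq_bigr (fun bt => n%:R^-1 * \sum_i batch_pmf bt * sqn (c i + err (init bt) i))); last first.
  by move=> bt _; rewrite /msqn mulrCA mulr_sumr.
rewrite -mulr_sumr /msqn /nubar2 -mulrA -mulrDr ler_pM2l ?invr_gt0 //.
rewrite exchange_big mulr_suml -big_split /=; apply: ler_sum => i _.
under eq_bigr => bt _ do rewrite -own_noise.
by apply: le_trans (batch_second_moment _ _) _; rewrite own_power mulrC.
Qed.

Lemma init_mean_err :
  \sum_bt batch_pmf bt * sqn (mean (err (init bt))) <= nubar2 / (n%:R * B%:R).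
Proof.
have e bt : mean (err (init bt)) =
    0 + \sum_ik (n%:R^-1 * B%:R^-1) *: sample_noise ik (bt ik).
  rewrite add0r /mean -(eq_bigr _ (fun i _ => own_noise bt i)) exchange_big /= scaler_sumr.
  apply: eq_bigr => -[i k] _ /=.
  rewrite -scaler_suml scalerA; congr (_ * _ *: _).
  rewrite (bigD1 i) //= [X in _ + X]big1 /own ?eqxx ?addr0 // => j /negPf ji.
  by rewrite eq_sym ji.
under eq_bigr => bt _ do rewrite e.
apply: le_trans (batch_second_moment (fun=> n%:R^-1 * B%:R^-1) _) _.
rewrite sqn0 add0r -!mulr_sumr /nubar2; apply: le_of_eq.
by field; rewrite !gt_eqF.
Qed.

Lemma tracked_init bt : tracked (init bt).
Proof.
rewrite /tracked /= /track_update mean_mix //; apply: eq_mean => i.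
by rewrite add0r subr0.
Qed.

Lemma lyapunov_init :
  \sum_bt batch_pmf bt * lyapunov (init bt) <=
  4 * G / eta * (Vstar - V theta0) + c1 * (nubar2 / (n%:R * B%:R)) +
  c2 * (nubar2 / B%:R) +
  c4 * (rho ^+ 2 * (msqn (fun i => vgrad i theta0) + nubar2 / B%:R)).
Proof.
have h1 := ler_wpM2l c1_ge0 init_mean_err.
have := init_second_moment (fun=> 0); rewrite msqn_cst // sqn0 add0r.
under eq_bigr => bt _ do rewrite (eq_msqn (fun i => add0r (err (init bt) i))).
move=> /(ler_wpM2l c2_ge0) h2.
have h3 := init_second_moment (fun i => vgrad i theta0).
have /(ler_wpM2l c4_ge0) h4 : \sum_bt batch_pmf bt * msqn (dev (track (init bt))) <=
    rho ^+ 2 * (msqn (fun i => vgrad i theta0) + nubar2 / B%:R).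
  apply: le_trans (ler_wpM2l (sqr_ge0 rho) h3); rewrite mulr_sumr.
  apply: ler_sum => bt _; rewrite [leRHS]mulrCA ler_wpM2l ?batch_pmf_is_pmf.1 //.
  apply: le_trans (msqn_dev_mix_le n0 W_row W_col _ 0) _; rewrite -/rho ler_wpM2l ?sqr_ge0 //.
  apply: le_of_eq; apply: eq_msqn => i.
  by rewrite /err /= add0r !subr0 addrC subrK.
have cons0 bt : consensus (init bt) = 0.
  rewrite /consensus /= (eq_msqn (y := fun=> 0)); first by rewrite msqn_cst // sqn0.
  by move=> i; rewrite /dev mean_cst // subrr.
have -> : \sum_bt batch_pmf bt * lyapunov (init bt) =
   4 * G / eta * (Vstar - V theta0) +
   c1 * (\sum_bt batch_pmf bt * sqn (mean (err (init bt)))) +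
   c2 * (\sum_bt batch_pmf bt * msqn (err (init bt))) +
   c4 * (\sum_bt batch_pmf bt * msqn (dev (track (init bt)))).
  rewrite -[4 * G / eta * _]mul1r -{1}batch_pmf_is_pmf.2 mulr_suml !mulr_sumr -!big_split.
  by apply: eq_bigr => bt _; rewrite /lyapunov cons0 /= mean_cst //; ring.
by rewrite !lerD.
Qed.

(** The run splits into the initial batch, the later samples and the uniform output
    index, which averages the cost over agents and iterations. *)
Lemma mean_cost_le :
  pmf_mean (@run_pmf R S A n d H gamma pol envs b W T B eta beta theta0)
    (fun z => sqn (mgrad (theta_out gamma pol envs b W eta beta theta0 z))) <=
  T.+1%:R^-1 * (4 * G / eta * (Vstar - V theta0) + c1 * (nubar2 / (n%:R * B%:R)) +
    c2 * (nubar2 / B%:R) +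
    c4 * (rho ^+ 2 * (msqn (fun i => vgrad i theta0) + nubar2 / B%:R))) + noise_floor.
Proof.
have TR : 0 < T.+1%:R :> R by rewrite ltr0n.
pose st_at (w : samples S A n H T B) t := state_at gamma pol envs b W eta beta theta0 w t.
have -> : pmf_mean (@run_pmf R S A n d H gamma pol envs b W T B eta beta theta0)
    (fun z => sqn (mgrad (theta_out gamma pol envs b W eta beta theta0 z))) =
  T.+1%:R^-1 * \sum_bt batch_pmf bt * \sum_(u : T.-tuple {ffun 'I_n -> traj})
    path_pmf step_pmf step (init bt) u *
    \sum_(t < T.+1) cost (foldl step (init bt) (take t u)).
  rewrite /pmf_mean.
  rewrite -(pair_bigA _ (fun w it => run_pmf gamma pol envs b W eta beta theta0 (w, it) *
    sqn (mgrad (theta_out gamma pol envs b W eta beta theta0 (w, it))))) /=.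
  rewrite (eq_bigr (fun w => T.+1%:R^-1 * (samples_pmf gamma pol envs b W eta beta theta0 w *
    \sum_(t < T.+1) cost (st_at w t)))); last first.
    move=> w _.
    rewrite -(pair_bigA _ (fun i t => run_pmf gamma pol envs b W eta beta theta0 (w, (i, t)) *
      sqn (mgrad (theta_out gamma pol envs b W eta beta theta0 (w, (i, t)))))) /=.
    rewrite exchange_big mulrCA !mulr_sumr; apply: eq_bigr => t _ /=.
    rewrite /cost /msqn !mulr_sumr; apply: eq_bigr => i _.
    by rewrite /run_pmf /theta_out /st_at /= invfM; ring.
  rewrite -mulr_sumr; congr (_ * _).
  rewrite -(pair_bigA _ (fun bt u => samples_pmf gamma pol envs b W eta beta theta0 (bt, u) *
    \sum_(t < T.+1) cost (st_at (bt, u) t))) /=.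
  apply: eq_bigr => bt _; rewrite mulr_sumr; apply: eq_bigr => u _.
  rewrite mulrA; congr (_ * _); rewrite /samples_pmf; congr (_ * _).
  by rewrite /= pair_big /=; apply: eq_bigr => -[].
have drift bt : \sum_(u : T.-tuple {ffun 'I_n -> traj})
    path_pmf step_pmf step (init bt) u *
    \sum_(t < T.+1) cost (foldl step (init bt) (take t u)) <=
    lyapunov (init bt) + T.+1%:R * noise_floor.
  apply: (lyapunov_bound step_pmf_is_pmf (Inv := tracked)).
  - by move=> st tau; exact: tracked_step.
  - exact: lyapunov_ge0.
  - exact: lyapunov_drift.
  - exact: tracked_init.
rewrite -(ler_pM2l TR) mulrA divff ?gt_eqF // mul1r mulrDr mulrA divff ?gt_eqF // mul1r.
apply: le_trans (mean_le batch_pmf_is_pmf drift) _.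
under eq_bigr => bt _ do rewrite mulrDr.
by rewrite big_split -mulr_suml batch_pmf_is_pmf.2 mul1r lerD2r lyapunov_init.
Qed.

End Drift.

(** * Constants of the rate and the convergence theorem *)

(** Term by term, using [kappa <= kappa ^+ 2] and [T <= T1]. *)
Lemma rate_constants_le (R : realFieldType)
  (T T1 m B mu G beta eta r nu Delta rho2 g : R) :
  0 < T -> T <= T1 -> 0 < m -> 0 < B -> 0 < mu -> mu <= G -> 0 < beta ->
  0 < eta -> 0 < r -> 0 <= nu -> 0 <= Delta -> 0 <= rho2 -> 0 <= g ->
  let kappa := G / mu in
  T1^-1 * (4 * G / eta * Delta + mean_err_weight kappa beta * (nu / (m * B)) +
    err_weight kappa beta r * (nu / B) +
    track_weight kappa r * (rho2 * (m^-1 * g + nu / B))) +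
  (m^-1 * mean_err_weight kappa beta + err_weight kappa beta r +
    track_weight kappa r * (2 / r)) * (2 * beta ^+ 2 * nu) <=
  8 * G ^+ 2 * Delta / (T * eta * mu)
  + 76 * nu * kappa ^+ 2 / (m * T * beta * B)
  + 152 * beta * nu * kappa ^+ 2 / m
  + 44 * rho2 * nu * kappa ^+ 2 / (T * B * r)
  + 352 * beta ^+ 2 * nu * kappa ^+ 2 / r ^+ 2
  + 352 * beta * nu * kappa ^+ 2 / (T * B * r ^+ 2)
  + 704 * nu * kappa ^+ 2 * beta ^+ 3 / r ^+ 2
  + 44 * rho2 * kappa ^+ 2 / (m * T * r) * g.
Proof.
move=> T0 TT m0 B0 mu0 muG b0 eta0 r0 nu0 D0 rho0 g0.
have Gp : 0 < G by apply: lt_le_trans muG.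
pose k := G / mu; rewrite -/k /=.
have kE : k = G / mu by [].
have k1 : 1 <= k by rewrite kE ler_pdivlMr // mul1r.
clearbody k.
have k0 : 0 <= k by apply: le_trans k1.
have GE : G = k * mu by rewrite kE divfK // gt_eqF.
have pos x y : 0 <= x -> 0 < y -> 0 <= x / y by move=> x0 y0; rewrite divr_ge0 // ltW.
have up (a c z : R) : 0 <= a -> a <= c -> 0 <= z -> a * k * z <= c * k ^+ 2 * z.
  move=> a0 ac z0; apply: ler_wpM2r => //; rewrite expr2 mulrA.
  by apply: ler_pM; rewrite ?mulr_ge0 // -[leLHS]mulr1 ler_pM.
pose z1 := mu * k * Delta / (T * eta).
pose z2 := nu / (m * T * beta * B).
pose z3 := beta * nu / m.
pose z4 := rho2 * nu / (T * B * r).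
pose z5 := beta ^+ 2 * nu / r ^+ 2.
pose z6 := beta * nu / (T * B * r ^+ 2).
pose z7 := nu * beta ^+ 3 / r ^+ 2.
pose z8 := rho2 * g / (m * T * r).
have z10 : 0 <= z1 by rewrite pos ?mulr_ge0 ?mulr_gt0 // ltW.
have z20 : 0 <= z2 by rewrite pos ?mulr_gt0.
have z30 : 0 <= z3 by rewrite pos ?mulr_ge0 // ltW.
have z40 : 0 <= z4 by rewrite pos ?mulr_ge0 ?mulr_gt0.
have b0' := ltW b0.
have z50 : 0 <= z5 by rewrite pos ?mulr_ge0 ?exprn_gt0.
have z60 : 0 <= z6 by rewrite pos ?mulr_ge0 ?mulr_gt0 ?exprn_gt0 // ltW.
have z70 : 0 <= z7 by rewrite pos ?mulr_ge0 ?exprn_ge0 ?exprn_gt0 // ltW.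
have z80 : 0 <= z8 by rewrite pos ?mulr_ge0 ?mulr_gt0.
set A := (X in T1^-1 * X); set F := (X in _ + X <= _).
have AE : T^-1 * A = 4 * z1 + 4 * k * z2 + 16 * k * z6 + 4 * k * (z8 + z4).
  rewrite /A /mean_err_weight /err_weight /track_weight /z1 /z2 /z4 /z6 /z8 GE.
  by field; rewrite !gt_eqF.
have A0 : 0 <= A.
  have k4 : 0 <= 4 * k by rewrite mulr_ge0.
  have k16 : 0 <= 16 * k by rewrite mulr_ge0.
  have : 0 <= T^-1 * A.
    rewrite AE; apply: addr_ge0 (mulr_ge0 k4 (addr_ge0 z80 z40)).
    apply: addr_ge0 (mulr_ge0 k16 z60).
    by apply: addr_ge0 (mulr_ge0 k4 z20); exact: mulr_ge0.
  by rewrite pmulr_rge0 // invr_gt0.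
have FE : F = 8 * k * z3 + 32 * k * z7 + 16 * k * z5.
  rewrite /F /mean_err_weight /err_weight /track_weight /z3 /z5 /z7.
  by field; rewrite !gt_eqF.
have h1 : T1^-1 * A <= T^-1 * A.
  by rewrite ler_wpM2r // lef_pV2 ?posrE // (lt_le_trans T0).
have -> : 8 * G ^+ 2 * Delta / (T * eta * mu) = 8 * k * z1.
  by rewrite GE /z1; field; rewrite !gt_eqF.
have -> : 76 * nu * k ^+ 2 / (m * T * beta * B) = 76 * k ^+ 2 * z2 by rewrite /z2; ring.
have -> : 152 * beta * nu * k ^+ 2 / m = 152 * k ^+ 2 * z3 by rewrite /z3; ring.
have -> : 44 * rho2 * nu * k ^+ 2 / (T * B * r) = 44 * k ^+ 2 * z4 by rewrite /z4; ring.
have -> : 352 * beta ^+ 2 * nu * k ^+ 2 / r ^+ 2 = 352 * k ^+ 2 * z5 by rewrite /z5; ring.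
have -> : 352 * beta * nu * k ^+ 2 / (T * B * r ^+ 2) = 352 * k ^+ 2 * z6 by rewrite /z6; ring.
have -> : 704 * nu * k ^+ 2 * beta ^+ 3 / r ^+ 2 = 704 * k ^+ 2 * z7 by rewrite /z7; ring.
have -> : 44 * rho2 * k ^+ 2 / (m * T * r) * g = 44 * k ^+ 2 * z8 by rewrite /z8; ring.
have u1 : 4 * z1 <= 8 * k * z1 by apply: ler_wpM2r => //; lra.
have u2 : 4 * k * z2 <= 76 * k ^+ 2 * z2 by apply: up; rewrite ?ler_nat.
have u3 : 8 * k * z3 <= 152 * k ^+ 2 * z3 by apply: up; rewrite ?ler_nat.
have u4 : 4 * k * z4 <= 44 * k ^+ 2 * z4 by apply: up; rewrite ?ler_nat.
have u5 : 16 * k * z5 <= 352 * k ^+ 2 * z5 by apply: up; rewrite ?ler_nat.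
have u6 : 16 * k * z6 <= 352 * k ^+ 2 * z6 by apply: up; rewrite ?ler_nat.
have u7 : 32 * k * z7 <= 704 * k ^+ 2 * z7 by apply: up; rewrite ?ler_nat.
have u8 : 4 * k * z8 <= 44 * k ^+ 2 * z8 by apply: up; rewrite ?ler_nat.
rewrite FE; apply: le_trans (lerD h1 (lexx _)) _; rewrite AE (mulrDr (4 * k)).
have := lerD (lerD (lerD u1 u2) (lerD u3 u4)) (lerD (lerD u5 u6) (lerD u7 u8)).
set s1 := 8 * k * z1; set s2 := 76 * k ^+ 2 * z2; set s3 := 152 * _ * _.
set s4 := 44 * _ * z4; set s5 := 352 * _ * z5; set s6 := 352 * _ * z6.
set s7 := 704 * _ * _; set s8 := 44 * _ * z8.
set v1 := 4 * z1; set v2 := 4 * k * z2; set v3 := 8 * k * z3; set v4 := 4 * k * z4.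
set v5 := 16 * k * z5; set v6 := 16 * k * z6; set v7 := 32 * k * z7; set v8 := 4 * k * z8.
lra.
Qed.

(** For dimension zero, where [mu <= G] does not follow from the Fisher bounds. *)
Lemma rate_terms_ge0 (R : realFieldType) (b1 b2 b3 b4 b5 b6 b7 b8 : R)
  (T m B mu G kappa beta eta r nu Delta rho2 g : R) :
  0 <= b1 -> 0 <= b2 -> 0 <= b3 -> 0 <= b4 -> 0 <= b5 -> 0 <= b6 -> 0 <= b7 ->
  0 <= b8 -> 0 < T -> 0 < m -> 0 < B -> 0 < mu -> 0 < beta ->
  0 < eta -> 0 < r -> 0 <= nu -> 0 <= Delta -> 0 <= rho2 -> 0 <= g ->
  0 <= b1 * G ^+ 2 * Delta / (T * eta * mu)
  + b2 * nu * kappa ^+ 2 / (m * T * beta * B)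
  + b3 * beta * nu * kappa ^+ 2 / m
  + b4 * rho2 * nu * kappa ^+ 2 / (T * B * r)
  + b5 * beta ^+ 2 * nu * kappa ^+ 2 / r ^+ 2
  + b6 * beta * nu * kappa ^+ 2 / (T * B * r ^+ 2)
  + b7 * nu * kappa ^+ 2 * beta ^+ 3 / r ^+ 2
  + b8 * rho2 * kappa ^+ 2 / (m * T * r) * g.
Proof.
move=> *; have k2 : 0 <= kappa ^+ 2 by rewrite sqr_ge0.
have G2 : 0 <= G ^+ 2 by rewrite sqr_ge0.
move: (kappa ^+ 2) (G ^+ 2) k2 G2 => k2 G2 *.
by do ?[apply: addr_ge0 | apply: mulr_ge0 | rewrite invr_ge0 | apply: exprn_ge0 | exact: ltW].
Qed.

Section Smoothness.
Variables (R : realType) (d : nat).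
Implicit Types x u w : 'cV[R]_d.

(** The first-order Taylor estimate for a function with Lipschitz gradient, applied
    to [- F] along the line from [x] in direction [u]. *)
Lemma descent_lemma (F : 'cV[R]_d -> R) (gF : 'cV[R]_d -> 'cV[R]_d) (L : R) :
  (forall x u (t : R), is_derive t 1 (fun s => F (line x u s)) (dotv u (gF (line x u t)))) ->
  (forall x y w, `|dotv w (gF y - gF x)| <= L * enorm w * enorm (y - x)) ->
  forall x u, F x + dotv (gF x) u - L / 2 * sqn u <= F (x + u).
Proof.
move=> dF lipF x u.
have h (t : R) : is_derive t 1 (fun s => -1 * F (line x u s)) (-1 * dotv u (gF (line x u t))).
  exact: is_derive_scale.
have := taylor_unit_le h (K := L * sqn u); rewrite !line0.
have -> : line x u 1 = x + u by rewrite /line scale1r.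
rewrite (dotvC u) => hT.
suff : -1 * F (x + u) <= -1 * F x + -1 * dotv (gF x) u + L * sqn u / 2 by lra.
apply: hT => t /andP[t0 t1].
have := lipF x (line x u t) (- u).
have -> : line x u t - x = t *: u by rewrite /line addrAC subrr add0r.
rewrite -sqn_enorm enormZ (ger0_norm t0).
rewrite (_ : enorm (- u) = enorm u); last by rewrite !enorm_sqrt sqnN.
move=> hl; have := le_trans (ler_norm _) hl.
rewrite dotvNl dotvDr dotvNr (dotvC u (gF x)) (dotvC (gF x)) (dotvC u (gF (line x u t))); lra.
Qed.

End Smoothness.

Lemma pmf_inhabited (R : realType) (X : finType) (p : X -> R) : is_pmf p -> exists x : X, True.
Proof.
case=> _ p1; case: (pickP (fun _ : X => true)) => [x _|X0]; first by exists x.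
by move/eqP: p1; rewrite big1 1?eq_sym ?oner_eq0 // => x; have := X0 x.
Qed.

Section MeanValue.
Variables (R : realType) (S A : finType) (n d H : nat) (gamma : R).
Variable pol : 'cV[R]_d -> S -> A -> R.
Variable envs : 'I_n -> environment R S A.
Hypotheses (pol_gt0 : forall theta s a, 0 < pol theta s a)
  (pol_pmf : forall theta s, is_pmf (pol theta s))
  (pol_diff : forall s a, twice_differentiable (fun theta => ln (pol theta s a))).

Let V := mean_value H gamma pol envs.
Let gV x := mean (fun i => value_grad H gamma pol (envs i) x).

Lemma is_derive_mean_value x u t : is_derive (t : R) 1
  (fun s => V (line x u s)) (dotv u (gV (line x u t))).
Proof.
rewrite /gV /mean dotvZr dotv_sumr; apply: is_derive_scale.
by apply: is_derive_fin_sum => i; exact: is_derive_value.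
Qed.

Lemma grad_mean_value x : grad V x = gV x.
Proof.
apply: grad_unique => u.
have := is_derive_mean_value x u 0; rewrite line0 dotvC => h.
by have := (is_derive_lineP V x u 0 _).2 h; rewrite line0.
Qed.

Lemma mean_value_smooth L : (0 < n)%N ->
  (forall i x y w, `|dotv w (value_grad H gamma pol (envs i) y - value_grad H gamma pol (envs i) x)|
     <= L * enorm w * enorm (y - x)) ->
  forall x u, V x + dotv (gV x) u - L / 2 * sqn u <= V (x + u).
Proof.
move=> n0 lip; apply: descent_lemma; first exact: is_derive_mean_value.
move=> x y w; rewrite /gV -meanB /mean dotvZr dotv_sumr.
have nR : 0 < n%:R :> R by rewrite ltr0n.
rewrite normrM ger0_norm ?invr_ge0 ?(ltW nR) // ler_pdivrMl //.
apply: (le_trans (ler_norm_sum _ _ _)).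
apply: (@le_trans _ _ (\sum_(i < n) L * enorm w * enorm (y - x))).
  by apply: ler_sum => i _; exact: lip.
by rewrite sumr_const card_ord mulr_natl.
Qed.

End MeanValue.

Theorem theorem2p4 (R : realType) (S A : finType) (n d H : nat)
  (n_gt0 : (0 < n)%N)
  (envs : 'I_n -> environment R S A)
  (gamma : R) (gamma01 : 0 <= gamma < 1)
  (pol : 'cV[R]_d -> S -> A -> R)
  (pol_gt0 : forall theta s a, 0 < pol theta s a)
  (pol_pmf : forall theta s, is_pmf (pol theta s))
  (pol_diff : forall s a, twice_differentiable (fun theta => ln (pol theta s a)))
  (b : 'I_n -> R) (absb : R) (b_le : forall i, `|b i| <= absb)
  (edge : rel 'I_n) (edge_sym : symmetric edge) (edge_irr : irreflexive edge)
  (edge_connected : forall i j, connect edge i j)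
  (W : 'M[R]_n) (W_ge0 : forall i j, 0 <= W i j)
  (W_edge : forall i j, ~~ (edge i j || (i == j)) -> W i j = 0)
  (T B : nat) (T_gt0 : (0 < T)%N) (B_gt0 : (0 < B)%N)
  (eta beta : R) (theta0 : 'cV[R]_d)
  (G M varpi muF : R) (nu : 'I_n -> R) :
  let V_ i := value H gamma pol (envs i) in
  let V := mean_value H gamma pol envs in
  let ones : 'cV[R]_n := const_mx 1 in
  let rho := specnorm (W - n%:R^-1 *: (ones *m ones^T)) in
  let Vstar := sup (range V) in
  let nubar2 := n%:R^-1 * \sum_(i < n) nu i ^+ 2 in
  let kappa := G / muF in
  let Delta := Vstar - V theta0 in
  let L := smooth_L H gamma G M in
  let Phi2 := Phi2 H gamma G M varpi absb in
  W *m ones = ones ->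
  ones^T *m W = ones^T ->
  0 <= rho < 1 ->
  has_ubound (range V) ->
  (forall theta s a, enorm (score pol theta s a) ^+ 2 <= G) ->
  (forall theta s a, specnorm (hess (fun x => ln (pol x s a)) theta) <= M) ->
  (forall i (theta theta' : 'cV[R]_d),
     pmf_var (traj_pmf pol (envs i) theta)
       (fun tau : traj S A H => is_weight pol tau theta' theta) <= varpi) ->
  (forall i theta,
     pmf_mean (traj_pmf pol (envs i) theta)
       (fun tau : traj S A H =>
          enorm (grad_est gamma pol (envs i) (b i) tau theta
                 - grad (V_ i) theta) ^+ 2) <= nu i ^+ 2) ->
  0 < muF ->
  (forall i theta, psdmx (fisher H pol (envs i) theta - muF%:M)) ->
  0 < eta < muF * (1 - rho ^+ 2) ^+ 3 /
            (kappa * Num.sqrt (1632 * 10 ^+ 3 * (L ^+ 2 + Phi2))) ->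
  1632 * 10 ^+ 3 * (L ^+ 2 + Phi2) * kappa ^+ 2 * eta ^+ 2 /
    (n%:R * muF ^+ 2 * (1 - rho ^+ 2) ^+ 6) <= beta < n%:R^-1 ->
  pmf_mean (run_pmf gamma pol envs b W eta beta theta0)
    (fun r : run S A n H T B =>
       enorm (grad V (theta_out gamma pol envs b W eta beta theta0 r)) ^+ 2) <=
  8 * G ^+ 2 * Delta / (T%:R * eta * muF)
  + 76 * nubar2 * kappa ^+ 2 / (n%:R * T%:R * beta * B%:R)
  + 152 * beta * nubar2 * kappa ^+ 2 / n%:R
  + 44 * rho ^+ 2 * nubar2 * kappa ^+ 2 / (T%:R * B%:R * (1 - rho ^+ 2))
  + 352 * beta ^+ 2 * nubar2 * kappa ^+ 2 / (1 - rho ^+ 2) ^+ 2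
  + 352 * beta * nubar2 * kappa ^+ 2 / (T%:R * B%:R * (1 - rho ^+ 2) ^+ 2)
  + 704 * nubar2 * kappa ^+ 2 * beta ^+ 3 / (1 - rho ^+ 2) ^+ 2
  + 44 * rho ^+ 2 * kappa ^+ 2 / (n%:R * T%:R * (1 - rho ^+ 2))
    * \sum_(i < n) enorm (grad (V_ i) theta0) ^+ 2.
Proof.
move=> V_ V ones rho Vstar nubar2 kappa Delta L Phi W_row W_col rho01 V_bound.
move=> score_le hess_le varpi_le nu_le mu0 psd eta_lt beta_ge.
have nR : 0 < n%:R :> R by rewrite ltr0n.
pose i0 : 'I_n := Ordinal n_gt0.
have [s0 _] := pmf_inhabited (init_pmf (envs i0)).
have [a0 _] := pmf_inhabited (pol_pmf theta0 s0).
have G_ge0 : 0 <= G := le_trans (sqr_ge0 _) (score_le theta0 s0 a0).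
have M_ge0 : 0 <= M := le_trans (specnorm_ge0 _) (hess_le theta0 s0 a0).
have absb_ge0 : 0 <= absb := le_trans (normr_ge0 _) (b_le i0).
have p_pmf i x : is_pmf (@traj_pmf R S A d H pol (envs i) x) by exact: traj_pmf_is_pmf.
have varpi_ge0 : 0 <= varpi.
  apply: le_trans (varpi_le i0 theta0 theta0).
  by apply: sumr_ge0 => tau _; rewrite mulr_ge0 ?sqr_ge0 ?(p_pmf i0 theta0).1.
have /andP[gamma0 gamma1] := gamma01.
have L_ge0 : 0 <= L.
  by rewrite /L /smooth_L divr_ge0 ?subr_ge0 ?(ltW gamma1) // mulr_ge0 // addr_ge0 // mulr_ge0.
have Phi_ge0 : 0 <= Phi.
  rewrite /Phi /Defs.Phi2 addr_ge0 ?sqr_ge0 // mulr_ge0 ?sqr_ge0 // /C_omega2.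
  by rewrite !mulr_ge0 ?addr_ge0 // !mulr_ge0.
have /andP[rho0 rho1] := rho01.
set r := 1 - rho ^+ 2 in eta_lt beta_ge *.
have r0 : 0 < r by rewrite subr_gt0 expr_lt1.
(* The numeral matters only through its lower bound; hiding it keeps the
   arithmetic below symbolic. *)
set N := 1632 * 10 ^+ 3 in eta_lt beta_ge.
have N_large : 40 * 100 <= N by rewrite /N -natrX -!natrM ler_nat.
clearbody N.
have N0 : 0 < N by apply: lt_le_trans N_large; rewrite mulr_gt0.
have /andP[eta0 eta_lt'] := eta_lt.
have kappa_ge0 : 0 <= kappa by rewrite divr_ge0 // ltW.
(* If the denominator vanished, the upper bound on [eta] would be zero. *)
have den0 : 0 < kappa * Num.sqrt (N * (L ^+ 2 + Phi)).
  rewrite lt_def mulr_ge0 ?sqrtr_ge0 // andbT; apply/eqP => e.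
  by move: eta_lt'; rewrite e invr0 mulr0 ltNge ltW.
have G0 : 0 < G.
  rewrite lt_def G_ge0 andbT; apply/eqP => e.
  by move: den0; rewrite /kappa e !mul0r ltxx.
have kappa0 : 0 < kappa by rewrite divr_gt0.
have X0 : 0 < N * (L ^+ 2 + Phi) by rewrite -sqrtr_gt0 -(pmulr_rgt0 _ kappa0).
have mu2 : 0 < muF ^+ 2 by rewrite exprn_gt0.
pose q := eta ^+ 2 / muF ^+ 2.
have eta_small : N * (L ^+ 2 + Phi) * kappa ^+ 2 * q <= r ^+ 6.
  rewrite /q mulrA ler_pdivrMr //.
  have h : eta * (kappa * Num.sqrt (N * (L ^+ 2 + Phi))) <= muF * r ^+ 3.
    by rewrite -ler_pdivlMr // ltW.
  have : (eta * (kappa * Num.sqrt (N * (L ^+ 2 + Phi)))) ^+ 2 <= (muF * r ^+ 3) ^+ 2.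
    by rewrite ler_pXn2r ?nnegrE // mulr_ge0 ?exprn_ge0 // ltW.
  have -> : r ^+ 6 * muF ^+ 2 = (muF * r ^+ 3) ^+ 2 by ring.
  apply: le_trans; rewrite !(exprMn _ eta) !(exprMn _ kappa) sqr_sqrtr ?(ltW X0) //.
  by apply: le_of_eq; ring.
have /andP[beta_ge' beta_lt] := beta_ge.
have r6 : 0 < r ^+ 6 by rewrite exprn_gt0.
have beta_large : N * (L ^+ 2 + Phi) * kappa ^+ 2 * q <= beta * n%:R * r ^+ 6.
  rewrite /q mulrA ler_pdivrMr //; move: beta_ge'; rewrite ler_pdivrMr ?mulr_gt0 //.
  by move=> h; apply: le_trans h _; apply: le_of_eq; ring.
have beta0 : 0 < beta.
  apply: lt_le_trans beta_ge'; apply: divr_gt0; last by rewrite !mulr_gt0.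
  by apply: mulr_gt0; [apply: mulr_gt0|]; rewrite ?exprn_gt0.
have beta1 : beta <= 1.
  by apply/ltW/(lt_le_trans beta_lt); rewrite invf_le1 // ler1n.
have gradE i x : grad (V_ i) x = value_grad H gamma pol (envs i) x by rewrite /V_ grad_value.
have fisherG i x w : dotv w (fisher H pol (envs i) x *m w) <= G * sqn w.
  exact: fisher_le.
have V_le x : V x <= Vstar.
  by apply: ub_le_sup => //; exists x.
have Delta_ge0 : 0 <= Delta by rewrite subr_ge0.
have nubar_ge0 : 0 <= nubar2.
  by rewrite /nubar2 mulr_ge0 ?invr_ge0 ?(ltW nR) // sumr_ge0 // => i _; rewrite sqr_ge0.
have gsum_ge0 : 0 <= \sum_(i < n) enorm (grad (V_ i) theta0) ^+ 2.
  by apply: sumr_ge0 => i _; rewrite sqr_ge0.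
have TR : 0 < T%:R :> R by rewrite ltr0n.
have BR : 0 < B%:R :> R by rewrite ltr0n.
(* In dimension zero all gradients vanish; otherwise the Fisher bounds, tested at a
   basis vector, compare [muF] and [G]. *)
have [d0|d0] := posnP d.
  have e0 (x : 'cV[R]_d) : enorm x = 0.
    by rewrite /enorm big1 ?sqrtr0 // => -[k kd]; exfalso; move: kd; rewrite d0.
  rewrite /pmf_mean big1; last by move=> z _; rewrite e0 expr0n mulr0.
  by apply: rate_terms_ge0; rewrite ?ler0n ?sqr_ge0.
have muG : muF <= G.
  pose k0 : 'I_d := Ordinal d0; pose w : 'cV[R]_d := delta_mx k0 0.
  have w1 : sqn w = 1 by rewrite /sqn dotv_delta mxE !eqxx.
  have := le_trans (psdmx_ge (psd i0 theta0) w) (fisherG i0 theta0 w).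
  by rewrite w1 !mulr1.
have T1 : T%:R <= T.+1%:R :> R by rewrite ler_nat.
have rho2_ge0 := sqr_ge0 rho.
have := rate_constants_le TR T1 nR BR mu0 muG beta0 eta0 r0 nubar_ge0 Delta_ge0 rho2_ge0 gsum_ge0.
apply: le_trans.
pose vg i := value_grad H gamma pol (envs i).
have kappa1 : 1 <= kappa by rewrite ler_pdivlMr // mul1r.
have b01 : 0 < beta <= 1 by rewrite beta0.
have vgrad_lip i x y : sqn (vg i y - vg i x) <= L ^+ 2 * sqn (y - x).
  exact: (value_grad_sqn_lipschitz _ pol_gt0 pol_pmf pol_diff gamma01 score_le hess_le).
have V_smooth : forall x u, V x + dotv (mgrad vg x) u - L / 2 * sqn u <= V (x + u).
  apply: mean_value_smooth => // i x y w.
  exact: (value_grad_lipschitz _ pol_gt0 pol_pmf pol_diff gamma01 score_le hess_le).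
have unbiased i x : \sum_(tau : traj S A H) traj_pmf pol (envs i) x tau *: grad_est gamma pol (envs i) (b i) tau x = vg i x.
  exact: grad_est_unbiased.
have weighted_unbiased i x y : \sum_(tau : traj S A H) traj_pmf pol (envs i) x tau *:
    (is_weight pol tau y x *: grad_est gamma pol (envs i) (b i) tau y) = vg i y.
  exact: weighted_grad_est_unbiased.
have variance_le i x : \sum_(tau : traj S A H) traj_pmf pol (envs i) x tau *
    sqn (grad_est gamma pol (envs i) (b i) tau x - vg i x) <= nu i ^+ 2.
  apply: le_trans (nu_le i x); apply: ler_sum => tau _.
  by rewrite sqn_enorm gradE.
have difference_le i x y : \sum_(tau : traj S A H) traj_pmf pol (envs i) x tau *
    sqn (grad_est gamma pol (envs i) (b i) tau x -
         is_weight pol tau y x *: grad_est gamma pol (envs i) (b i) tau y)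
    <= 2 * Phi * sqn (y - x).
  by apply: grad_est_difference_second_moment => //; exact: varpi_le.
have precond_norm i x y : muF ^+ 2 * sqn (invmx (fisher H pol (envs i) x) *m y) <= sqn y.
  exact: invmx_sqn_le.
have precond_asc i z x y :
    (2 * G)^-1 * (sqn x + sqn y) - (2 * muF)^-1 * sqn (y - x) <=
    dotv x (invmx (fisher H pol (envs i) z) *m y).
  exact: invmx_form_polar.
have := mean_cost_le n_gt0 W_row W_col W_ge0 rho01 eta0 b01 mu0 G0 L_ge0 Phi_ge0
  p_pmf unbiased weighted_unbiased variance_le difference_le vgrad_lip
  precond_norm precond_asc V_smooth V_le kappa1 N_large eta_small beta_large T theta0 B_gt0.
rewrite (_ : n%:R^-1 * \sum_(i < n) enorm (grad (V_ i) theta0) ^+ 2 = msqn (vg^~ theta0)); last first.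
  by congr (_ * _); apply: eq_bigr => i _; rewrite sqn_enorm gradE.
apply: le_trans; apply: ler_sum => z _.
by rewrite sqn_enorm grad_mean_value.
Qed.
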